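(* Let $H$ be a unital ring and $R \subset H$ a central subring such that $H$ is a free Frobenius extension of $R$. Assume that $R$ is a regular ring, that the centre $Z = Z(H)$ of $H$ is Gorenstein and integrally closed, and that $H$ is a prime ring whose PI degree is invertible in $H$. Let $\mathfrak{m}$ be a maximal ideal of $R$, let $\mathbb{K} = R/\mathfrak{m}$, and assume that the finite-dimensional $\mathbb{K}$-algebra $A = H/\mathfrak{m}H$ is split over $\mathbb{K}$. Let $A = A_1 \oplus \cdots \oplus A_k$ be the block decomposition of $A$, and let $C_{\mathbb{K}} = C_{\mathbb{K},1} \oplus \cdots \oplus C_{\mathbb{K},k}$ be the corresponding decomposition of the Cartan map $C_{\mathbb{K}} \colon K_0(A) \otimes_{\mathbb{Z}} \mathbb{K} \to G_0(A) \otimes_{\mathbb{Z}} \mathbb{K}$. If the rank over $\mathbb{K}$ of every $C_{\mathbb{K},i}$ is non-zero, then the rank over $\mathbb{K}$ of each $C_{\mathbb{K},i}$ is exactly one.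
   Context: Free Frobenius extension: a ring $H$ with a central subring $R$ is a free Frobenius extension of $R$ if $H$ is a free $R$-module of finite rank and there exist an $R$-linear ring automorphism $\alpha$ of $H$ and an isomorphism of $H$-bimodules ${}_1H_{\alpha^{-1}} \to \mathrm{Hom}_R(H,R)$. Here ${}_1H_{\alpha^{-1}}$ equals $H$ as a left $H$-module, with right action $h \cdot a = h\,\alpha^{-1}(a)$, and $\mathrm{Hom}_R(H,R)$ has the bimodule structure $(afb)(x) = f(bxa)$. PI degree: since $H$ is prime and a finite module over the central subring $R$, it is a prime PI ring; its PI degree is the integer $d \geq 1$ such that $H \otimes_Z \mathrm{Frac}(Z)$ is a central simple $\mathrm{Frac}(Z)$-algebra of dimension $d^2$. Cartan map: $K_0(A)$ is the Grothendieck group of finitely generated projective $A$-modules, $G_0(A)$ the Grothendieck group of all finitely generated $A$-modules, and the Cartan map $C \colon K_0(A) \to G_0(A)$ is the canonical map $[P] \mapsto [P]$. In the bases of indecomposable projectives $P(\lambda)$ and simples $L(\lambda)$ it is given by the matrix of multiplicities $[P(\lambda):L(\mu)]$. $C_{\mathbb{K}}$ is the map $C \otimes_{\mathbb{Z}} \mathbb{K}$. The block decomposition of $A$ is its decomposition into indecomposable two-sided ideals, and $C_{\mathbb{K},i}$ is the Cartan map of $A_i$ tensored with $\mathbb{K}$. (The rank of $C_{\mathbb{K}}$ or $C_{\mathbb{K},i}$ over $\mathbb{K}$ is called its $p$-rank, where $p \geq 0$ is the characteristic of $\mathbb{K}$.) *)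

(* Defs.v *)
From HB Require Import structures.
From mathcomp Require Import all_boot all_order all_algebra all_field.
From mathcomp Require Import boolp.

Set Implicit Arguments.
Unset Strict Implicit.
Unset Printing Implicit Defensive.

Import GRing.Theory.
Local Open Scope ring_scope.

(* Rings, fields and modules are arbitrary, possibly infinite, so their ideals *)
(* and submodules are Prop-valued predicates.  Modules are left modules.       *)
(* Localizations, scalar extensions and Grothendieck groups are pinned down up *)
(* to unique isomorphism by their characteristic properties.                   *)

Section CommutativeAlgebra.
Variable A : comNzRingType.
Implicit Types (I J p m : A -> Prop).

Definition ideal I : Prop :=
  [/\ I 0, forall x y, I x -> I y -> I (x + y) & forall a x, I x -> I (a * x)].

Definition prime_ideal p : Prop :=
  [/\ ideal p, ~ p 1 & forall x y, p (x * y) -> p x \/ p y].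

Definition maximal_ideal m : Prop :=
  [/\ ideal m, ~ m 1 &
      forall J, ideal J -> (forall x, m x -> J x) -> ~ J 1 -> forall x, J x -> m x].

Definition generates n (g : 'I_n -> A) I : Prop :=
  forall x, I x <-> exists c : 'I_n -> A, x = \sum_i c i * g i.

Definition noetherian : Prop :=
  forall I, ideal I -> exists n (g : 'I_n -> A), generates g I.

Definition prime_chain d (c : nat -> A -> Prop) : Prop :=
  (forall i, (i <= d)%N -> prime_ideal (c i)) /\
  (forall i, (i < d)%N ->
     (forall x, c i x -> c i.+1 x) /\ exists x, c i.+1 x /\ ~ c i x).

Definition krull_dim d : Prop :=
  (exists c, prime_chain d c) /\ ~ (exists c, prime_chain d.+1 c).

Definition local_ring m : Prop :=
  maximal_ideal m /\ forall m', maximal_ideal m' -> forall x, m' x <-> m x.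

Definition regular_local_ring : Prop :=
  noetherian /\
  exists m d (g : 'I_d -> A), [/\ local_ring m, krull_dim d & generates g m].

(* L, with the map f, is the localization of A at the prime ideal p. *)
Definition localization_at p (L : comNzRingType) (f : {rmorphism A -> L}) : Prop :=
  [/\ forall s, ~ p s -> exists u, f s * u = 1,
      forall y, exists a s, ~ p s /\ f s * y = f a
    & forall a, f a = 0 <-> exists s, ~ p s /\ s * a = 0].

End CommutativeAlgebra.

Definition regular_ring (A : comNzRingType) : Prop :=
  noetherian A /\
  forall p : A -> Prop, prime_ideal p ->
    exists (L : comNzRingType) (f : {rmorphism A -> L}),
      localization_at p f /\ regular_local_ring L.

Section Modules.
Variable A : nzRingType.

Definition short_exact (M N P : lmodType A)
    (i : {linear M -> N}) (q : {linear N -> P}) : Prop :=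
  [/\ injective i, forall z, exists y, q y = z
    & forall y, q y = 0 <-> exists x, i x = y].

Definition injective_module (E : lmodType A) : Prop :=
  forall (M N : lmodType A) (i : {linear M -> N}) (f : {linear M -> E}),
    injective i -> exists g : {linear N -> E}, forall x, g (i x) = f x.

Fixpoint inj_dim_le (n : nat) (M : lmodType A) : Prop :=
  if n is n'.+1 then
    exists (E N : lmodType A) (i : {linear M -> E}) (q : {linear E -> N}),
      [/\ injective_module E, short_exact i q & inj_dim_le n' N]
  else injective_module M.

Definition projective_module (P : lmodType A) : Prop :=
  forall (M N : lmodType A) (q : {linear M -> N}) (f : {linear P -> N}),
    (forall z, exists y, q y = z) ->
    exists g : {linear P -> M}, forall x, q (g x) = f x.

Definition finitely_generated (M : lmodType A) : Prop :=
  exists n (g : 'I_n -> M), forall x, exists c : 'I_n -> A, x = \sum_i c i *: g i.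

Definition fg_projective (P : lmodType A) : Prop :=
  finitely_generated P /\ projective_module P.

Definition submodule (M : lmodType A) (U : M -> Prop) : Prop :=
  [/\ U 0, forall x y, U x -> U y -> U (x + y) & forall a x, U x -> U (a *: x)].

Definition simple_module (M : lmodType A) : Prop :=
  (exists x : M, x <> 0) /\
  forall U : M -> Prop, submodule U -> (forall x, U x -> x = 0) \/ (forall x, U x).

End Modules.

Definition gorenstein_ring (A : comNzRingType) : Prop :=
  noetherian A /\
  forall m : A -> Prop, maximal_ideal m ->
    exists (L : comNzRingType) (f : {rmorphism A -> L}),
      localization_at m f /\ exists n, inj_dim_le n (L^o : lmodType L).

Definition integrally_closed (D : idomainType) : Prop :=
  forall x : {fraction D},
    integralOver (@FracField.tofrac D) x -> exists a, x = FracField.tofrac a.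

Definition prime_ring (H : nzRingType) : Prop :=
  forall a b : H, (forall x, a * x * b = 0) -> a = 0 \/ b = 0.

Section Centre.
Variable H : nzRingType.

Definition centre_pred : {pred H} := fun z => `[< forall h, z * h = h * z >].

Lemma centre_predP z : reflect (forall h, z * h = h * z) (z \in centre_pred).
Proof. exact: asboolP. Qed.

Fact centre_subring : subring_closed centre_pred.
Proof.
split=> [|x y /centre_predP cx /centre_predP cy|x y /centre_predP cx /centre_predP cy];
  apply/centre_predP => h; first by rewrite mul1r mulr1.
- by rewrite mulrBl mulrBr cx cy.
- by rewrite -mulrA cy mulrA cx mulrA.
Qed.

HB.instance Definition _ := GRing.isSubringClosed.Build H centre_pred centre_subring.

Record centre := Centre { centre_val : H; _ : centre_val \in centre_pred }.

HB.instance Definition _ := [isSub for centre_val].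
HB.instance Definition _ := [Choice of centre by <:].
HB.instance Definition _ := [SubChoice_isSubNzRing of centre by <:].

Fact centre_mulC : @commutative centre centre *%R.
Proof. by move=> x y; apply: val_inj => /=; have /centre_predP := valP x; apply. Qed.

HB.instance Definition _ := GRing.PzRing_hasCommutativeMul.Build centre centre_mulC.

Definition centre_unit : pred centre := fun x => `[< exists y, y * x = 1 >].
Definition centre_inv (x : centre) : centre :=
  if pselect (exists y, y * x = 1) is left ex then projT1 (cid ex) else x.

Fact centre_mulVx : {in centre_unit, left_inverse 1 centre_inv *%R}.
Proof.
by move=> x /asboolP ux; rewrite /centre_inv; case: pselect => // ex; case: cid.
Qed.
Fact centre_unitPl (x y : centre) : y * x = 1 -> centre_unit x.
Proof. by move=> yx; apply/asboolP; exists y. Qed.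
Fact centre_invr_out : {in [predC centre_unit], centre_inv =1 id}.
Proof. by move=> x /asboolPn ux; rewrite /centre_inv; case: pselect. Qed.

HB.instance Definition _ := GRing.ComNzRing_hasMulInverse.Build centre
  centre_mulVx centre_unitPl centre_invr_out.

End Centre.

(* The centre of a prime ring, as an integral domain. *)
Definition prime_centre (H : nzRingType) of prime_ring H : Type := centre H.

Section PrimeCentre.
Variables (H : nzRingType) (pH : prime_ring H).
HB.instance Definition _ := GRing.ComUnitRing.on (prime_centre pH).

Fact prime_centre_idomain (x y : prime_centre pH) :
  x * y = 0 -> (x == 0) || (y == 0).
Proof.
move=> /(congr1 val) /= xy0; have /centre_predP cx := valP (x : centre H).
case: (pH (a := val (x : centre H)) (b := val (y : centre H))).
- by move=> h; rewrite cx -mulrA xy0 mulr0.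
- by move=> x0; apply/orP; left; apply/eqP/val_inj.
- by move=> y0; apply/orP; right; apply/eqP/val_inj.
Qed.

HB.instance Definition _ := GRing.ComUnitRing_isIntegral.Build (prime_centre pH)
  prime_centre_idomain.
End PrimeCentre.

(* The K-module V, with the map t (= fun x => x (x) 1), is the scalar extension *)
(* of M along phi : S -> K, where S acts on the additive group M by act.        *)
Definition scalar_extension (S K : nzRingType) (phi : S -> K) (M : zmodType)
    (act : S -> M -> M) (V : lmodType K) (t : {additive M -> V}) : Prop :=
  (forall s x, t (act s x) = phi s *: t x) /\
  forall (W : lmodType K) (f : {additive M -> W}),
    (forall s x, f (act s x) = phi s *: f x) ->
    (exists g : {linear V -> W}, forall x, g (t x) = f x) /\
    (forall g g' : {linear V -> W},
       (forall x, g (t x) = f x) -> (forall x, g' (t x) = f x) -> g =1 g').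

Section FiniteDimensionalAlgebras.
Variables (K : fieldType) (A : falgType K).

Definition two_sided_ideal (U : {vspace A}) : Prop :=
  ({:A} * U <= U)%VS /\ (U * {:A} <= U)%VS.

Definition central_simple : Prop :=
  'Z({:A})%VS = 1%VS /\
  forall U : {vspace A}, two_sided_ideal U -> U = 0%VS \/ U = fullv.

Definition indecomposable_ideal (U : {vspace A}) : Prop :=
  [/\ two_sided_ideal U, U <> 0%VS &
      forall V W : {vspace A}, two_sided_ideal V -> two_sided_ideal W ->
        (V + W)%VS = U -> (V :&: W)%VS = 0%VS -> V = 0%VS \/ W = 0%VS].

(* A direct summand of A in the lattice of two-sided ideals has an identity, so *)
(* it is no restriction to take the blocks in {aspace A}; this makes each       *)
(* subvs_of (B i) a unital K-algebra.                                           *)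
Definition block_decomposition k (B : 'I_k -> {aspace A}) : Prop :=
  [/\ (\sum_i B i)%VS = fullv, directv (\sum_i B i)%VS
    & forall i, indecomposable_ideal (B i)].

Definition split_algebra : Prop :=
  forall (M : lmodType A) (f : {linear M -> M}), simple_module M ->
    exists c : K, forall x, f x = c%:A *: x.

End FiniteDimensionalAlgebras.

(* H (x)_Z Frac(Z), as a ring under H, is central simple of dimension d ^ 2. *)
Definition PI_degree (H : nzRingType) (pH : prime_ring H) (d : nat) : Prop :=
  (0 < d)%N /\
  exists (Q : falgType {fraction (prime_centre pH)}) (phi : {rmorphism H -> Q}),
    [/\ scalar_extension (@FracField.tofrac (prime_centre pH))
          (fun (z : prime_centre pH) h => val (z : centre H) * h) phi,
        central_simple Q & \dim {:Q} = (d ^ 2)%N].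

(* In 1_H_(alpha^-1) the bimodule action is a . h . b = a * h * alpha^-1 b. *)
Definition free_frobenius_extension (R : comNzRingType) (H : algType R) : Prop :=
  (exists n, exists2 v : H -> 'rV[R]_n, linear v & bijective v) /\
  exists (alpha : {lrmorphism H -> H}) (alphaV : H -> H)
         (Phi : H -> {linear H -> R^o}),
    [/\ cancel alpha alphaV, cancel alphaV alpha
      & forall a b h x, Phi (a * h * alphaV b) x = Phi h (b * x * a)] /\
    [/\ forall g h x, Phi (g + h) x = Phi g x + Phi h x,
        forall g h, Phi g =1 Phi h -> g = h
      & forall f : {linear H -> R^o}, exists h, Phi h =1 f].

Definition exact_additive (A : nzRingType) (C : lmodType A -> Prop)
    (G : zmodType) (cl : lmodType A -> G) : Prop :=
  forall (M N P : lmodType A) (i : {linear M -> N}) (q : {linear N -> P}),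
    C M -> C N -> C P -> short_exact i q -> cl N = cl M + cl P.

(* G, with the class map cl, is the Grothendieck group of the A-modules *)
(* satisfying C, for short exact sequences of such modules; the values  *)
(* of cl at other modules are irrelevant.                               *)
Definition grothendieck_group (A : nzRingType) (C : lmodType A -> Prop)
    (G : zmodType) (cl : lmodType A -> G) : Prop :=
  exact_additive C cl /\
  forall (X : zmodType) (f : lmodType A -> X), exact_additive C f ->
    (exists g : {additive G -> X}, forall M, C M -> g (cl M) = f M) /\
    (forall g g' : {additive G -> X},
       (forall M, C M -> g (cl M) = f M) ->
       (forall M, C M -> g' (cl M) = f M) -> g =1 g').

(* The map CK : K_0(A) (x)_Z K -> G_0(A) (x)_Z K induced by the Cartan map of A. *)
Definition cartan_map (K : fieldType) (A : falgType K) (K0K G0K : vectType K)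
    (CK : 'Hom(K0K, G0K)) : Prop :=
  exists (K0 G0 : zmodType) (clK : lmodType A -> K0) (clG : lmodType A -> G0)
         (C : {additive K0 -> G0})
         (tK : {additive K0 -> K0K}) (tG : {additive G0 -> G0K}),
    [/\ grothendieck_group (@fg_projective A) clK,
        grothendieck_group (@finitely_generated A) clG
      & forall P, fg_projective P -> C (clK P) = clG P] /\
    [/\ scalar_extension (intr : int -> K) (fun n x => x *~ n) tK,
        scalar_extension (intr : int -> K) (fun n x => x *~ n) tG
      & forall x, CK (tK x) = tG (C x)].

(* f identifies B with the quotient of A by I. *)
Definition quotient_map (A B : nzRingType) (I : A -> Prop)
    (f : {rmorphism A -> B}) : Prop :=
  (forall y, exists x, f x = y) /\ forall x, f x = 0 <-> I x.

Definition extended_ideal (R : comNzRingType) (H : algType R) (m : R -> Prop)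
    (h : H) : Prop :=
  exists n (a : 'I_n -> R) (g : 'I_n -> H),
    (forall i, m (a i)) /\ h = \sum_i a i *: g i.

(* Main.v *)
Require Import Defs.
From HB Require Import structures.
From mathcomp Require Import all_boot all_order all_algebra all_field.
From mathcomp Require Import boolp.

Set Implicit Arguments.
Unset Strict Implicit.
Unset Printing Implicit Defensive.

Import GRing.Theory.
Local Open Scope ring_scope.

(** The proof runs through the bilinear form [trmul a b], the trace over [K] of
    [x |-> a * x * b] on [A].

    If [P] is a finitely generated projective module over a finite-dimensional
    algebra, the dual basis lemma gives an element [b] with
    [tr (a | P) = trmul a b] for all [a] ([projective_trace]).  Over a split
    algebra the characters of the simple modules are linearly independent, so
    the class of a module in [G_0 (x) K] is a linear function of its character
    ([class_formula], which rests on the density theorem [density]).  Hence the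
    rank of the Cartan map over [K] is at most the rank of [trmul]
    ([cartan_rank_le1]), and it is enough to see that [trmul] has rank at most
    one on each block.

    Suppose first that [trmul a _ = trmul z _] for some central [z].  On a block
    with identity [e] a central element is a scalar [c] plus a nilpotent, since
    the block is indecomposable and [A] is split; multiplication by a central
    nilpotent contributes no trace, so [trmul z b = c * trmul e b] for [b] in
    the block ([central_scalar]).  That is the bound on the rank.

    It remains to find [z], and this is where the geometry of [H] enters.  Let
    [F] be the fraction field of the centre [Z] and [Q] the central simple
    [F]-algebra obtained from [H], of dimension [d ^ 2].  Up to scalars
    [t x = tr (y |-> x * y)] is the only trace function on [Q], so that, [d]
    being invertible, [Q] is the direct sum of [F] and the span [ker t] of the
    commutators ([ltrace0_commutators]).  For [a] in [H] the element [t a] of [F]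
    is integral over [Z] because [H] is a lattice in [Q] stable under [a]
    ([integral_trace]); as [Z] is integrally closed, [t a] lies in [Z].  Now
    [d ^ 2 * a - t a] has [t] equal to zero, hence is a sum of commutators in
    [Q], and a nonzero central multiple of it is a sum of central multiples of
    commutators in [H].  The trace over [R] of [x |-> a * x * b] on the free
    module [H] does not see commutators in [a] and is linear over the domain
    [R], so it takes the same value at [d ^ 2 * a] as at the central element
    [t a] ([central_reduction]).  Reducing modulo [m] gives the claim for
    [trmul] ([trmul_reduction]). *)

(** * Traces of endomorphisms *)

Section Trace.
Variable K : fieldType.
Implicit Types U V : vectType K.
Import VectorInternalTheory.

Definition lftr V (f : 'End(V)) : K := \tr (f2mx f).

Lemma mul_f2mx U V (f : 'Hom(U, V)) x : x *m f2mx f = v2r (f (r2v x)).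
Proof. by rewrite unlock /= !r2vK. Qed.

Lemma lftrC U V (f : 'Hom(U, V)) (g : 'Hom(V, U)) :
  lftr (f \o g)%VF = lftr (g \o f)%VF.
Proof.
have f2mx_comp (X Y Z : vectType K) (u : 'Hom(Y, Z)) (v : 'Hom(X, Y)) :
    f2mx (u \o v)%VF = f2mx v *m f2mx u.
  apply/row_matrixP => i.
  by rewrite !rowE mulmxA !mul_f2mx comp_lfunE v2rK.
by rewrite /lftr !f2mx_comp mxtrace_mulC.
Qed.

Fact lftr_is_linear V : linear (@lftr V : 'End(V) -> K^o).
Proof.
move=> k f g; rewrite /lftr -linearP; congr mxtrace.
apply/row_matrixP => i; rewrite !rowE mulmxDr -scalemxAr !mul_f2mx.
by rewrite add_lfunE scale_lfunE linearP.
Qed.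
HB.instance Definition _ V := GRing.isLinear.Build K 'End(V) K^o _ (@lftr V)
  (@lftr_is_linear V).

Lemma lftr0 V : lftr (0 : 'End(V)) = 0. Proof. exact: (linear0 (@lftr V)). Qed.
Lemma lftrD V (f g : 'End(V)) : lftr (f + g) = lftr f + lftr g.
Proof. exact: (linearD (@lftr V)). Qed.
Lemma lftrZ V k (f : 'End(V)) : lftr (k *: f) = k * lftr f.
Proof. exact: (linearZ_LR (@lftr V)). Qed.
Lemma lftr_sum V I r (P : pred I) (f : I -> 'End(V)) :
  lftr (\sum_(i <- r | P i) f i) = \sum_(i <- r | P i) lftr (f i).
Proof. exact: (linear_sum (@lftr V)). Qed.

Lemma lftr1 V : lftr (\1%VF : 'End(V)) = (dim V)%:R.
Proof.
rewrite /lftr; suff -> : f2mx (\1%VF : 'End(V)) = 1%:M by rewrite mxtrace1.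
by apply/row_matrixP => i; rewrite !rowE mulmx1 mul_f2mx id_lfunE r2vK.
Qed.

Lemma lftr_rank1 V (f : 'End(V)) (phi : {linear V -> K^o}) (y : V) :
  (forall x, f x = phi x *: y) -> lftr f = phi y.
Proof.
move=> fE; pose h : 'Hom(V, K^o) := linfun phi.
have glin : linear (fun k : K^o => k *: y).
  by move=> a b c; rewrite scalerDl scalerA.
pose gl : {linear K^o -> V} := HB.pack (fun k : K^o => k *: y)
  (GRing.isLinear.Build K K^o V _ _ glin).
have -> : f = (linfun gl \o h)%VF.
  by apply/lfunP => x; rewrite comp_lfunE !lfunE fE.
rewrite lftrC; have -> : (h \o linfun gl)%VF = phi y *: \1%VF.
  apply/lfunP => x.
  by rewrite comp_lfunE scale_lfunE !lfunE /= linearZ /= /GRing.scale /= mulrC.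
by rewrite lftrZ lftr1 mulr1.
Qed.

Lemma lftr_basis V n (X : n.-tuple V) (f : 'End(V)) : basis_of fullv X ->
  lftr f = \sum_i coord X i (f X`_i).
Proof.
move=> bX.
have rlin i : linear (fun x : V => coord X i x *: f X`_i).
  by move=> a x y; rewrite linearP /= scalerDl scalerA.
pose r i : {linear V -> V} := HB.pack (fun x : V => coord X i x *: f X`_i)
  (GRing.isLinear.Build K V V _ _ (rlin i)).
have fE : f = \sum_i linfun (r i).
  apply/lfunP => x; rewrite {1}(coord_basis bX (memvf x)) linear_sum sum_lfunE.
  by apply: eq_bigr => i _; rewrite lfunE linearZ.
rewrite {1}fE lftr_sum; apply: eq_bigr => i _.
by apply: (@lftr_rank1 _ _ (coord X i)) => x; rewrite (lfunE (r i)).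
Qed.

(** Writing [M = C *m B] through its column and row bases, [B *m C] has the
    same trace as [M] and a nilpotency index smaller by one. *)
Lemma nilp_mxtrace N n (M : 'M[K]_n) : iter N (mulmx M) 1%:M = 0 -> \tr M = 0.
Proof.
elim: N n M => [|N IHN] n M /= MN0.
  by rewrite -[M]mulmx1 MN0 mulmx0 mxtrace0.
have [r [C [B [CB fB fC]]]] : exists r (C : 'M[K]_(n, r)) (B : 'M[K]_(r, n)),
    [/\ C *m B = M, row_free B & row_full C].
  exists (\rank M), (col_base M), (row_base M).
  by rewrite mulmx_base row_base_free col_base_full.
rewrite -CB mxtrace_mulC; apply: IHN.
have powE k : C *m iter k (mulmx (B *m C)) 1%:M *m B = iter k.+1 (mulmx M) 1%:M.
  elim: k => [|k IHk]; first by rewrite /= !mulmx1.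
  by rewrite [RHS]iterS -IHk iterS -CB !mulmxA.
move: MN0; rewrite -iterS -powE => /(congr1 (mulmx^~ (pinvmx B))).
rewrite mul0mx mulmxKp // => /(congr1 trmx); rewrite trmx_mul trmx0.
move/(congr1 (mulmx^~ (pinvmx C^T))); rewrite mul0mx mulmxKp.
  by move/(congr1 trmx); rewrite trmxK trmx0.
by rewrite /row_free mxrank_tr.
Qed.

Lemma lftr_nilp N V (f : 'End(V)) : (forall x, iter N f x = 0) -> lftr f = 0.
Proof.
move=> fN; apply: (@nilp_mxtrace N); apply/row_matrixP => i.
have E k x : x *m iter k (mulmx (f2mx f)) 1%:M = v2r (iter k f (r2v x)).
  elim: k x => [|k IHk] x; first by rewrite mulmx1 /= r2vK.
  by rewrite iterS mulmxA IHk mul_f2mx v2rK -iterSr.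
by rewrite row0 rowE E fN linear0.
Qed.

End Trace.

(** * Finite-dimensional representations and the density theorem *)

(** Classically, a subset closed under linear combinations contains a subspace of
    largest dimension, which must be all of it. *)
Lemma vspace_of_closed (K : fieldType) (V : vectType K) (P : V -> Prop) :
  P 0 -> (forall k x y, P x -> P y -> P (k *: x + y)) ->
  exists U : {vspace V}, forall x, x \in U <-> P x.
Proof.
move=> P0 PD; pose Q n := `[< exists U : {vspace V},
  \dim U = n /\ forall x, x \in U -> P x >].
have Q0 : exists n, Q n.
  exists 0%N; apply/asboolP; exists 0%VS; split; first exact: dimv0.
  by move=> x; rewrite memv0 => /eqP->.
have Qb n : Q n -> (n <= \dim {:V})%N.
  by move=> /asboolP[U [<- _]]; rewrite dimvS ?subvf.
case: (ex_maxnP Q0 Qb) => n /asboolP[U [dU UP]] maxn.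
exists U => x; split=> [|Px]; first exact: UP.
have UxP y : y \in (U + <[x]>)%VS -> P y.
  move=> /memv_addP[u uU [_ /vlineP[k ->] ->]]; rewrite addrC.
  by apply: PD => //; apply: UP.
have /maxn : Q (\dim (U + <[x]>)%VS) by apply/asboolP; exists (U + <[x]>)%VS.
rewrite -dU => dle; have /eqP -> : U == (U + <[x]>)%VS by rewrite eqEdim addvSl.
by rewrite (subvP (addvSr _ _)) ?memv_line.
Qed.

Section Representations.
Variables (K : fieldType) (A : falgType K).

(** A module given as a [K]-vector space with an action, so that subspaces,
    dimensions and traces are available; [repmod] below forgets back to a module
    over [A]. *)
Record rep := Rep {
  rep_sp :> vectType K;
  act : A -> 'End(rep_sp);
  act1 : act 1 = \1%VF;
  actM : forall a b, act (a * b) = (act a \o act b)%VF;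
  act_linear : linear act }.

HB.instance Definition _ (X : rep) :=
  GRing.isLinear.Build K A 'End(X) _ (@act X) (@act_linear X).

Implicit Types X Y : rep.

Lemma act1E X (x : X) : act X 1 x = x. Proof. by rewrite act1 id_lfunE. Qed.
Lemma actME X a b (x : X) : act X (a * b) x = act X a (act X b x).
Proof. by rewrite actM comp_lfunE. Qed.
Lemma actPE X k a b (x : X) :
  act X (k *: a + b) x = k *: act X a x + act X b x.
Proof. by rewrite linearP add_lfunE scale_lfunE. Qed.
Lemma actBE X a b (x : X) : act X (a - b) x = act X a x - act X b x.
Proof. by rewrite linearB add_lfunE opp_lfunE. Qed.

Definition stable X (U : {vspace X}) := forall a x, x \in U -> act X a x \in U.
Definition irreducible X :=
  dim X != 0%N /\ forall U : {vspace X}, stable U -> U = 0%VS \/ U = fullv.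
Definition intertwining X Y (f : 'Hom(X, Y)) :=
  forall a x, f (act X a x) = act Y a (f x).
Definition rep_iso X Y :=
  exists f : 'Hom(X, Y), intertwining f /\ bijective f.

Definition rep_split := forall X (f : 'End(X)),
  irreducible X -> intertwining f -> exists c, forall x, f x = c *: x.

Lemma schur X Y (f : 'Hom(X, Y)) : irreducible X -> irreducible Y ->
  intertwining f -> f != 0 -> rep_iso X Y.
Proof.
move=> [dX irrX] [dY irrY] fA f0; exists f; split=> //.
have /irrX[ker0|kerf] : stable (lker f).
- by move=> a x; rewrite !memv_ker fA => /eqP->; rewrite linear0.
- have /irrY[im0|imf] : stable (limg f).
  + by move=> a _ /memv_imgP[x _ ->]; rewrite -fA memv_img ?memvf.
  + case/eqP: f0; apply/lfunP => x; apply/eqP.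
    by rewrite zero_lfunE -memv0 -im0 memv_img ?memvf.
  exists (f^-1)%VF; first by apply: lker0_lfunK; apply/eqP.
  by move=> y; apply: limg_lfunVK; rewrite imf memvf.
case/eqP: f0; apply/lfunP => x; apply/eqP.
by rewrite zero_lfunE -memv_ker kerf memvf.
Qed.

(** Induction on the total dimension of the [W j].  Removing a line [<[y]>]
    from [W k] leaves a left ideal [L] of elements killing the rest, with
    [L y = S k] by irreducibility; if [x] is killed by what kills [W], then
    [l y |-> l x] is a well defined homomorphism [S k -> S t], hence zero or a
    scalar. *)
Lemma density m (S : 'I_m -> rep) (splitS : rep_split)
    (irrS : forall j, irreducible (S j))
    (nisoS : forall i j, i != j -> ~ rep_iso (S i) (S j))
    (W : forall j, {vspace S j}) t (x : S t) :
  (forall a, (forall j w, w \in W j -> act (S j) a w = 0) -> act (S t) a x = 0) ->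
  x \in W t.
Proof.
have [N] := ubnP (\sum_j \dim (W j))%N.
elim: N W t x => // N IHN W t x leN killx.
have [[k Wk0]|W0] := pselect (exists k, W k != 0%VS); last first.
  have {}W0 j : W j = 0%VS by apply/eqP/negbNE/negP => Wj; apply: W0; exists j.
  rewrite W0 memv0 -[x]act1E killx // => j w.
  by rewrite W0 memv0 => /eqP ->; rewrite linear0.
pose y := vpick (W k); pose Wk := (W k :\: <[y]>)%VS.
have y0 : y != 0 by rewrite vpick0.
have yW : y \in W k by apply: memv_pick.
have yWk : y \notin Wk.
  apply: contra y0 => yWk; rewrite -memv0 -(capv_diff (W k) <[y]>).
  by rewrite memv_cap yWk memv_line.
have WkE : (Wk + <[y]>)%VS = W k.
  by rewrite addv_diff; apply/addv_idPl; rewrite -memvE.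
pose W' := dfwith W Wk.
have W'k : W' k = Wk by rewrite /W' dfwith_in.
have W'j j : k != j -> W' j = W j by move=> kj; rewrite /W' dfwith_out.
have {leN}ltN : (\sum_j \dim (W' j) < N)%N.
  rewrite ltnS in leN; apply: leq_trans leN; rewrite (bigD1 k) //=.
  rewrite [X in (_ < X)%N](bigD1 k) //= W'k.
  rewrite (eq_bigr (fun j => \dim (W j))) => [|j]; last first.
    by rewrite eq_sym => /W'j ->.
  rewrite -addSn leq_add2r -WkE dimv_disjoint_sum ?capv_diff // dim_vline y0.
  by rewrite addn1.
pose L a := forall j w, w \in W' j -> act (S j) a w = 0.
have L0 : L 0 by move=> j w _; rewrite linear0 zero_lfunE.
have LD c a b : L a -> L b -> L (c *: a + b).
  by move=> La Lb j w wW; rewrite actPE La // Lb // scaler0 addr0.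
have LM a b : L b -> L (a * b).
  by move=> Lb j w wW; rewrite actME Lb // linear0.
have [a0 La0 a0y] : exists2 a, L a & act (S k) a y != 0.
  apply: contrapT => nex; case/negP: yWk; rewrite -W'k; apply: IHN => // a La.
  by apply/eqP/negbNE/negP => ay; apply: nex; exists a.
have Lfull u : exists a, L a /\ act (S k) a y = u.
  have [||U UP] := @vspace_of_closed K (S k)
      (fun u => exists a, L a /\ act (S k) a y = u).
  - by exists 0; rewrite linear0 zero_lfunE.
  - move=> c _ _ [a [La <-]] [b [Lb <-]]; exists (c *: a + b).
    by split; [exact: LD | exact: actPE].
  have stU : stable U.
    move=> a v /UP[b [Lb <-]]; apply/UP; exists (a * b).
    by split; [exact: LM | exact: actME].
  have [U0|Uf] := (irrS k).2 U stU; last by apply/UP; rewrite Uf memvf.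
  case/eqP: a0y; apply/eqP; rewrite -memv0 -U0; apply/UP; by exists a0.
(* well-definedness of [l y |-> l x] *)
have Lwd a : L a -> act (S k) a y = 0 -> act (S t) a x = 0.
  move=> La ay; apply: killx => j; have [->|kj] := eqVneq j k => w.
    rewrite -WkE => /memv_addP[w1 w1W [_ /vlineP[c ->] ->]].
    by rewrite linearD linearZ /= ay scaler0 addr0 La ?W'k.
  by rewrite -W'j 1?eq_sym // => /La.
pose g u := projT1 (cid (Lfull u)).
have gL u : L (g u) by rewrite /g; case: cid => a [].
have gy u : act (S k) (g u) y = u by rewrite /g; case: cid => a [].
have gE a : L a -> act (S t) (g (act (S k) a y)) x = act (S t) a x.
  move=> La; apply/eqP; rewrite -subr_eq0 -actBE; apply/eqP/Lwd.
    by rewrite -scaleN1r addrC; apply: LD.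
  by rewrite actBE gy subrr.
have hlin : linear (fun u => act (S t) (g u) x).
  move=> c u v; rewrite -[in LHS](gy u) -[in LHS](gy v) -actPE gE ?actPE //.
  exact: LD.
pose h : {linear S k -> S t} := HB.pack (fun u => act (S t) (g u) x)
  (GRing.isLinear.Build K (S k) (S t) _ _ hlin).
have hA : intertwining (linfun h).
  move=> a u; rewrite !lfunE /= -[in LHS](gy u) -actME gE ?actME //.
  exact: LM.
have [tk|kt] := eqVneq k t.
  subst t; have [c hc] := splitS _ _ (irrS k) hA.
  have : x - c *: y \in Wk.
    rewrite -W'k; apply: IHN => // a La; rewrite linearB linearZ /= -gE //.
    by rewrite -hc lfunE subrr.
  move=> xW; rewrite -WkE -[x](subrK (c *: y)).
  by rewrite memv_add // memvZ ?memv_line.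
have [h0|h0] := eqVneq (linfun h) 0; last first.
  by case: (nisoS k t kt); apply: schur h0.
have h0E u : act (S t) (g u) x = 0 by have := lfunE h u; rewrite h0 zero_lfunE.
by rewrite -W'j //; apply: IHN => // a La; rewrite -gE.
Qed.

(** The projection onto a line of [S t], extended by zero to the other
    [S j], is the action of some [a]. *)
Lemma dual_traces m (S : 'I_m -> rep) (splitS : rep_split)
    (irrS : forall j, irreducible (S j))
    (nisoS : forall i j, i != j -> ~ rep_iso (S i) (S j)) t :
  exists a, forall j, lftr (act (S j) a) = (j == t)%:R.
Proof.
have [dS irr_t] := irrS t; pose x := vpick {:S t}.
have x0 : x != 0 by rewrite vpick0 -dimv_eq0 dimvf.
pose W := @dfwith _ (fun j => {vspace S j}) (fun j => fullv) t (<[x]>^C)%VS.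
have xW : x \notin W t.
  rewrite /W dfwith_in; apply: contra x0 => xC; rewrite -memv0.
  by rewrite -(capv_compl <[x]>) memv_cap memv_line.
have [a aW ax] : exists2 a, forall j w, w \in W j -> act (S j) a w = 0 &
    act (S t) a x != 0.
  apply: contrapT => nex; case/negP: xW; apply: density => // a aW.
  by apply/eqP/negbNE/negP => ax; apply: nex; exists a.
have [b bax] : exists b, act (S t) (b * a) x = x.
  have [||U UP] := @vspace_of_closed K (S t)
      (fun u => exists b, act (S t) (b * a) x = u).
  - by exists 0; rewrite mul0r linear0 zero_lfunE.
  - move=> c _ _ [b <-] [b' <-]; exists (c *: b + b').
    by rewrite mulrDl -scalerAl actPE.
  have /irr_t[U0|Uf] : stable U.
  - move=> c v /UP[b <-]; apply/UP; exists (c * b); by rewrite -mulrA actME.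
  - by case/eqP: ax; apply/eqP; rewrite -memv0 -U0; apply/UP; exists 1; rewrite mul1r.
  by apply/UP; rewrite Uf memvf.
exists (b * a) => j; have [->|jt] := eqVneq j t; last first.
  suff -> : act (S j) (b * a) = 0 by rewrite lftr0.
  apply/lfunP => w; rewrite actME aW; first by rewrite linear0 zero_lfunE.
  by rewrite /W dfwith_out 1?eq_sym // memvf.
have bX : basis_of <[x]> [tuple x] by exact: seq1_basis.
pose phi : 'Hom(S t, K^o) :=
  (linfun (coord [tuple x] ord0 : S t -> K^o) \o projv <[x]>)%VF.
rewrite (@lftr_rank1 _ _ _ phi x) => [|u].
  rewrite /phi /= comp_lfunE projv_id ?memv_line // lfunE /=.
  by apply: etrans (coord_free ord0 ord0 (basis_free bX)) _; rewrite !eqxx.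
rewrite -[u in LHS](subrK (projv <[x]> u)) linearD /= actME aW ?linear0 ?add0r.
  rewrite [X in act _ _ X](coord_basis bX (memv_proj _ _)) big_ord1 linearZ /=.
  by rewrite bax /phi /= comp_lfunE lfunE.
by rewrite /W dfwith_in memv_projC.
Qed.

(** The elements of [A] dual to the characters of pairwise non-isomorphic
    irreducibles are independent, so there are at most [\dim A] of these. *)
Lemma complete_irreducibles (splitS : rep_split) :
  exists m (S : 'I_m -> rep), [/\ forall j, irreducible (S j),
    forall i j, i != j -> ~ rep_iso (S i) (S j)
    & forall X, irreducible X -> exists j, rep_iso (S j) X].
Proof.
pose P m := `[< exists S : 'I_m -> rep, (forall j, irreducible (S j)) /\
  forall i j, i != j -> ~ rep_iso (S i) (S j) >].
have P0 : exists m, P m.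
  by exists 0%N; apply/asboolP; unshelve eexists; [case | split=> -[]].
have Pb m : P m -> (m <= \dim {:A})%N.
  move=> /asboolP[S [irrS nisoS]].
  have dt t := dual_traces splitS irrS nisoS t.
  pose c t := projT1 (cid (dt t)).
  have cE j t : lftr (act (S j) (c t)) = (j == t)%:R.
    by rewrite /c; case: cid.
  pose X := [tuple c t | t < m].
  have fX : free X.
    apply/freeP => k k0 j.
    have := congr1 (fun a => lftr (act (S j) a)) k0.
    rewrite linear0 lftr0 linear_sum lftr_sum (bigD1 j) // big1 => [|i ij].
      by rewrite -tnth_nth tnth_mktuple linearZ lftrZ cE eqxx mulr1 /= addr0.
    by rewrite -tnth_nth tnth_mktuple linearZ lftrZ cE eq_sym (negPf ij) mulr0.
  by rewrite -[X in (X <= _)%N](size_tuple X) -(eqP fX) dimvS ?subvf.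
case: (ex_maxnP P0 Pb) => m /asboolP[S [irrS nisoS]] maxm.
exists m, S; split=> // X irrX; apply: contrapT => nX.
suff /maxm : P m.+1 by rewrite ltnn.
apply/asboolP; exists (fun i => if unlift ord0 i is Some j then S j else X).
split=> [i|i j]; first by case: unliftP.
case: unliftP => [i' ->|->]; case: unliftP => [j' ->|->].
- by move=> ij; apply: nisoS; apply: contra ij => /eqP ->.
- by move=> _ isoX; apply: nX; exists i'.
- move=> _ [f [fA [g fK gK]]]; apply: nX; exists j'.
  have flk : lker f == 0%VS by apply/lker0P/(can_inj fK).
  have fV : cancel f^-1%VF f by move=> y; rewrite -[y]gK lker0_lfunK.
  exists f^-1%VF; split; last first.
    by exists f => //; apply: lker0_lfunK.
  by move=> a x; apply: (can_inj fK); rewrite fA !fV.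
- by rewrite eqxx.
Qed.

End Representations.

(** * Modules, representations and Grothendieck groups *)

Section SubQuotient.
Variables (K : fieldType) (A : falgType K) (X : rep A) (U : {vspace X}).
Hypothesis stU : stable U.

Let i1 : 'Hom(subvs_of U, X) := linfun (@vsval K X U).
Let p1 : 'Hom(X, subvs_of U) := (linfun (vsproj U) \o projv U)%VF.
Let i2 : 'Hom(subvs_of U^C, X) := linfun (@vsval K X U^C).
Let p2 : 'Hom(X, subvs_of U^C) := (linfun (vsproj U^C) \o (\1 - projv U))%VF.

Let i1K x : p1 (i1 x) = x.
Proof. by rewrite comp_lfunE !lfunE /= projv_id ?subvsP ?vsvalK. Qed.
Let p1K x : i1 (p1 x) = projv U x.
Proof. by rewrite comp_lfunE !lfunE /= vsprojK ?memv_proj. Qed.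
Let p2K x : i2 (p2 x) = x - projv U x.
Proof.
rewrite !comp_lfunE add_lfunE opp_lfunE id_lfunE !lfunE /=.
by rewrite vsprojK ?memv_projC.
Qed.
Let i2K x : p2 (i2 x) = x.
Proof.
rewrite comp_lfunE add_lfunE opp_lfunE id_lfunE.
suff -> : projv U (i2 x) = 0 by rewrite subr0 !lfunE /= vsvalK.
by apply/eqP; rewrite -memv_ker lker_proj lfunE subvsP.
Qed.
Let p2U x : x \in U -> p2 x = 0.
Proof.
move=> xU; rewrite comp_lfunE add_lfunE opp_lfunE id_lfunE projv_id //.
by rewrite subrr linear0.
Qed.

Let sub_act a : 'End(subvs_of U) := (p1 \o act X a \o i1)%VF.
Let quo_act a : 'End(subvs_of U^C) := (p2 \o act X a \o i2)%VF.

Let sub_actE a x : sub_act a x = p1 (act X a (i1 x)).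
Proof. by rewrite !comp_lfunE. Qed.
Let quo_actE a x : quo_act a x = p2 (act X a (i2 x)).
Proof. by rewrite !comp_lfunE. Qed.

Let i1_act a x : i1 (sub_act a x) = act X a (i1 x).
Proof.
by rewrite sub_actE p1K projv_id // stU // lfunE subvsP.
Qed.
Let p2_act a x : p2 (act X a x) = quo_act a (p2 x).
Proof.
by rewrite quo_actE p2K !linearB /= [X in _ - X]p2U ?subr0 // stU // memv_proj.
Qed.

Fact sub_act1 : sub_act 1 = \1%VF.
Proof. by apply/lfunP => x; rewrite sub_actE act1E i1K id_lfunE. Qed.
Fact sub_actM a b : sub_act (a * b) = (sub_act a \o sub_act b)%VF.
Proof.
by apply/lfunP => x; rewrite comp_lfunE [LHS]sub_actE actME -!i1_act i1K.
Qed.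
Fact sub_act_linear : linear sub_act.
Proof.
move=> k a b; apply/lfunP => x.
by rewrite add_lfunE scale_lfunE !sub_actE actPE linearP.
Qed.
Definition subrep := Rep sub_act1 sub_actM sub_act_linear.

Fact quo_act1 : quo_act 1 = \1%VF.
Proof. by apply/lfunP => x; rewrite quo_actE act1E i2K id_lfunE. Qed.
Fact quo_actM a b : quo_act (a * b) = (quo_act a \o quo_act b)%VF.
Proof.
by apply/lfunP => x; rewrite comp_lfunE [LHS]quo_actE actME !p2_act i2K.
Qed.
Fact quo_act_linear : linear quo_act.
Proof.
move=> k a b; apply/lfunP => x.
by rewrite add_lfunE scale_lfunE !quo_actE actPE linearP.
Qed.
Definition quorep := Rep quo_act1 quo_actM quo_act_linear.

Lemma lftr_sub_quo a :
  lftr (act X a) = lftr (act subrep a) + lftr (act quorep a).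
Proof.
have -> : act X a = (((act X a \o i1) \o p1) + ((act X a \o i2) \o p2))%VF.
  apply/lfunP => x; rewrite add_lfunE 2!(comp_lfunE (act X a \o _)%VF).
  by rewrite 2!(comp_lfunE (act X a)) -linearD p1K p2K addrC subrK.
by rewrite lftrD lftrC [X in _ + X]lftrC !comp_lfunA.
Qed.

Lemma subrep_in : exists i : 'Hom(subrep, X),
  [/\ intertwining i, injective i & forall y, y \in U <-> exists x, i x = y].
Proof.
exists i1; split; [exact: i1_act | exact: can_inj i1K |] => y.
split=> [yU|[x <-]]; last by rewrite lfunE subvsP.
by exists (p1 y); rewrite p1K projv_id.
Qed.

Lemma quorep_out : exists (p : 'Hom(X, quorep)) (s : 'Hom(quorep, X)),
  [/\ intertwining p, cancel s p, forall x, p x = 0 <-> x \in U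
    & forall x, x - s (p x) \in U].
Proof.
exists p2, i2; split=> [a x||x|x].
- exact: p2_act.
- exact: i2K.
- split=> [p0|]; last exact: p2U.
  have := p2K x; rewrite p0 linear0 => /esym/eqP; rewrite subr_eq0 => /eqP->.
  exact: memv_proj.
- by rewrite p2K opprB addrC subrK memv_proj.
Qed.

End SubQuotient.

Section Modules.
Variables (K : fieldType) (A : falgType K).

Definition trmul (a b : A) : K := lftr (amull a \o amulr b)%VF.

Definition repmod (X : rep A) : Type := X.
HB.instance Definition _ (X : rep A) := GRing.Zmodule.on (repmod X).

Section RepmodLmodule.
Variable X : rep A.
Definition repmod_scale (a : A) (x : repmod X) : repmod X := act X a x.
Fact repmod_scaleA a b x :
  repmod_scale a (repmod_scale b x) = repmod_scale (a * b) x.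
Proof. by rewrite /repmod_scale actME. Qed.
Fact repmod_scale1 : left_id 1 repmod_scale.
Proof. by move=> x; rewrite /repmod_scale act1E. Qed.
Fact repmod_scaleDr : right_distributive repmod_scale +%R.
Proof. by move=> a x y; rewrite /repmod_scale linearD. Qed.
Fact repmod_scaleDl x : {morph repmod_scale^~ x : a b / a + b}.
Proof. by move=> a b; rewrite /repmod_scale linearD add_lfunE. Qed.
HB.instance Definition _ := GRing.Zmodule_isLmodule.Build A (repmod X)
  repmod_scaleA repmod_scale1 repmod_scaleDr repmod_scaleDl.
End RepmodLmodule.

Lemma act_alg (X : rep A) k (x : X) : act X k%:A x = k *: x.
Proof. by rewrite linearZ scale_lfunE act1E. Qed.

Lemma repmod_linear (X Y : rep A) (f : 'Hom(X, Y)) : intertwining f ->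
  exists g : {linear repmod X -> repmod Y}, forall x, g x = f x.
Proof.
move=> fA; have fl : linear (f : repmod X -> repmod Y).
  by move=> a x y; rewrite linearD; congr (_ + _); apply: fA.
pose g : {linear repmod X -> repmod Y} := HB.pack (f : repmod X -> repmod Y)
  (GRing.isLinear.Build A (repmod X) (repmod Y) _ _ fl).
by exists g.
Qed.

Lemma repmod_fg (X : rep A) : finitely_generated (repmod X).
Proof.
exists (\dim {:X}), (fun i => (vbasis {:X})`_i) => x.
exists (fun i => (coord (vbasis {:X}) i x)%:A).
rewrite [LHS](coord_vbasis (memvf (x : X))); apply: eq_bigr => i _.
by rewrite -[LHS]act_alg.
Qed.

Lemma irreducible_simple (X : rep A) : irreducible X -> simple_module (repmod X).
Proof.
move=> [dX irrX]; split.
  exists (vpick {:X}) => /eqP; rewrite -[_ == _]/(vpick {:X} == 0) vpick0.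
  by rewrite -dimv_eq0 dimvf (negPf dX).
move=> U [U0 UD UZ].
have [//|k x y Ux Uy|V VP] := @vspace_of_closed K X U.
  by rewrite -act_alg; apply: UD => //; apply: UZ.
have [V0|Vf] : V = 0%VS \/ V = fullv.
- by apply: irrX => a x /VP/(UZ a) aU; apply/VP.
- by left=> x /VP; rewrite V0 memv0 => /eqP.
- by right=> x; apply/VP; rewrite Vf memvf.
Qed.

Lemma split_rep : split_algebra A -> rep_split A.
Proof.
move=> splitA X f /irreducible_simple irrX /repmod_linear[g gE].
have [c gc] := splitA _ g irrX; exists c => x.
by rewrite -gE gc -[RHS]act_alg.
Qed.

(** A module on [n] generators is a quotient of [A ^ n], whose kernel is a
    stable subspace. *)
Lemma fg_repmod (M : lmodType A) : finitely_generated M ->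
  exists (X : rep A) (f : {linear repmod X -> M}), bijective f.
Proof.
move=> [n [g gM]]; pose V : vectType K := {ffun 'I_n -> A}.
have ml a : linear (fun v : V => [ffun i => a * v i] : V).
  by move=> k u v; apply/ffunP => i; rewrite !ffunE mulrDr scalerAr.
pose m a : 'End(V) := linfun (HB.pack (fun v : V => [ffun i => a * v i] : V)
  (GRing.isLinear.Build K V V _ _ (ml a)) : {linear V -> V}).
have mE a v i : m a v i = a * v i by rewrite lfunE /= ffunE.
have m1 : m 1 = \1%VF by apply/lfunP => v; apply/ffunP => i; rewrite mE id_lfunE mul1r.
have mM a b : m (a * b) = (m a \o m b)%VF.
  by apply/lfunP => v; apply/ffunP => i; rewrite comp_lfunE !mE mulrA.
have mlin : linear m.
  move=> k a b; apply/lfunP => v; apply/ffunP => i.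
  by rewrite add_lfunE scale_lfunE !ffunE !mE mulrDl scalerAl.
pose X := Rep m1 mM mlin.
pose s (v : V) : M := \sum_i v i *: g i.
have sD u v : s (u + v) = s u + s v.
  by rewrite /s -big_split; apply: eq_bigr => i _; rewrite ffunE scalerDl.
have sA a v : s (m a v) = a *: s v.
  by rewrite /s scaler_sumr; apply: eq_bigr => i _; rewrite mE scalerA.
have sZ k v : s (k *: v) = k%:A *: s v by rewrite -sA (act_alg (X := X)).
have s0 : s 0 = 0 by rewrite /s big1 // => i _; rewrite ffunE scale0r.
have [//|k u v su sv|U UP] := @vspace_of_closed K V (fun v => s v = 0).
  by rewrite sD sZ su sv scaler0 addr0.
have stU : stable (U : {vspace X}).
  by move=> a v /UP sv; apply/UP; rewrite sA sv scaler0.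
have [p [r [pA rK pU rpU]]] := quorep_out stU.
have sr v : s (r (p v)) = s v.
  rewrite -[in RHS](subrK (r (p v)) v) sD.
  by have /UP-> := rpU v; rewrite add0r.
have fl : linear ((fun x => s (r x)) : repmod (quorep stU) -> M).
  move=> a x y; rewrite linearD sD; congr (_ + _).
  by rewrite -[x in LHS]rK -sA -(sr (m a _)) pA.
pose F : {linear repmod (quorep stU) -> M} :=
  HB.pack ((fun x => s (r x)) : repmod (quorep stU) -> M)
    (GRing.isLinear.Build A (repmod (quorep stU)) M _ _ fl).
exists (quorep stU), F.
have gP x : exists v, s v = x.
  by have [c ->] := gM x; exists [ffun i => c i];
    apply: eq_bigr => i _; rewrite ffunE.
exists (fun x => p (projT1 (cid (gP x)))) => x; last by case: cid => v /= <-.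
case: cid => v /= sv; rewrite -[RHS]rK; apply/eqP; rewrite -subr_eq0 -linearB.
by apply/eqP/pU/UP; rewrite -scaleN1r addrC sD sZ sv scaleNr scale1r scaleN1r addNr.
Qed.

(** Dual basis lemma: if [x = \sum_i phi_i x *: g_i] on [P], then the trace of
    [a] on [P] is the sum of those of [x |-> a * x * phi_i g_i] on [A]. *)
Lemma projective_trace (P : lmodType A) (X : rep A) (f : {linear repmod X -> P}) :
  bijective f -> fg_projective P ->
  exists b, forall a, lftr (act X a) = trmul a b.
Proof.
move=> [f' fK f'K] [[n [g gP]] projP].
have ql : linear (fun v : 'rV[A]_n => \sum_i v 0 i *: g i).
  move=> a u v; rewrite scaler_sumr -big_split; apply: eq_bigr => i _.
  by rewrite !mxE scalerDl scalerA.
pose q : {linear 'rV[A]_n -> P} := HB.pack (fun v : 'rV[A]_n => \sum_i v 0 i *: g i)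
  (GRing.isLinear.Build A 'rV[A]_n P _ _ ql).
have [z|s sP] := projP _ _ q idfun.
  have [c ->] := gP z; exists (\row_i c i).
  by apply: eq_bigr => i _; rewrite mxE.
pose phi i (x : X) : A := s (f x) 0 i.
have phiA i a x : phi i (act X a x) = a * phi i x.
  rewrite /phi; have -> : f (act X a x) = a *: f x by rewrite -linearZ.
  by rewrite linearZ mxE.
have phil i : linear (phi i : X -> A).
  move=> k x y; rewrite -act_alg /phi !linearD mxE -!/(phi _ _) phiA.
  by rewrite -scalerAl mul1r.
pose ph i : {linear X -> A} := HB.pack (phi i)
  (GRing.isLinear.Build K X A _ _ (phil i)).
have evl i : linear (fun a : A => act X a (f' (g i))).
  by move=> k a b; rewrite actPE.
pose ev i : {linear A -> X} := HB.pack (fun a : A => act X a (f' (g i)))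
  (GRing.isLinear.Build K A X _ _ (evl i)).
pose b := \sum_i phi i (f' (g i)); exists b => a; rewrite /trmul.
have -> : act X a = (\sum_i (linfun (ev i) \o (amull a \o linfun (ph i))))%VF.
  apply/lfunP => x; rewrite sum_lfunE; apply: (can_inj fK).
  transitivity (q (s (f (act X a x)))); first by rewrite sP.
  rewrite linear_sum; apply: eq_bigr => i _.
  rewrite -/(phi i _) phiA !comp_lfunE !lfunE /=.
  by rewrite -[act X _ _]/(_ *: (_ : repmod X)) linearZ f'K.
rewrite lftr_sum.
have -> : (amull a \o amulr b)%VF =
    \sum_(i < n) (amull a \o amulr (phi i (f' (g i))))%VF.
  apply/lfunP => x; rewrite sum_lfunE comp_lfunE !lfunE /= !mulr_sumr.
  by apply: eq_bigr => i _; rewrite comp_lfunE !lfunE.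
rewrite lftr_sum; apply: eq_bigr => i _; rewrite lftrC; congr lftr.
by apply/lfunP => x; rewrite !comp_lfunE !lfunE /= phiA.
Qed.

(** ** Classes in a Grothendieck group *)

Section Classes.
Variables (G : zmodType) (cl : lmodType A -> G).
Hypothesis clD : exact_additive (@finitely_generated A) cl.

Lemma fg_surj (M N : lmodType A) (f : {linear M -> N}) :
  (forall y, exists x, f x = y) -> finitely_generated M -> finitely_generated N.
Proof.
move=> fS [n [g gM]]; exists n, (fun i => f (g i)) => y.
have [x <-] := fS y; have [c ->] := gM x; exists c.
by rewrite linear_sum; apply: eq_bigr => i _; rewrite linearZ.
Qed.

Lemma class_iso (M N : lmodType A) (f : {linear M -> N}) : bijective f ->
  finitely_generated M -> cl M = cl N.
Proof.
move=> bf fgM; have fgN : finitely_generated N.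
  by apply: (fg_surj (f := f)) fgM => y; case: bf => g _ gK; exists (g y); rewrite gK.
pose O : lmodType A := 'rV[A]_0.
have O0 (x : O) : x = 0 by apply/rowP => -[].
have fgO : finitely_generated O.
  by exists 0%N, (fun=> 0) => x; exists (fun=> 0); rewrite big_ord0.
pose z (P Q : lmodType A) : {linear P -> Q} := \0.
have ex0 (P Q : lmodType A) (g : {linear P -> Q}) : bijective g ->
    short_exact (z O P) g.
  move=> bg; split=> [x y _|y|y].
  - by rewrite [x]O0 [y]O0.
  - by case: bg => g' _ gK; exists (g' y).
  - split=> [gy|[x <-]]; last by rewrite linear0.
    by exists 0; apply: (bij_inj bg); rewrite gy !linear0.
(* additivity on [0 -> 0 -> 0 -> 0 -> 0] *)
have clO : cl O = 0.
  have bid : bijective (idfun : {linear O -> O}) by exists idfun.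
  have := clD fgO fgO fgO (ex0 _ _ _ bid).
  by move/(congr1 (fun x => x - cl O)); rewrite subrr addrK => /esym.
by have := clD fgO fgM fgN (ex0 _ _ _ bf); rewrite clO add0r.
Qed.

Lemma class_sub_quo (X : rep A) (U : {vspace X}) (stU : stable U) :
  cl (repmod X) = cl (repmod (subrep stU)) + cl (repmod (quorep stU)).
Proof.
have [i [/repmod_linear[i' iE] inji iP]] := subrep_in stU.
have [p [s [/repmod_linear[p' pE] sK pP _]]] := quorep_out stU.
apply: (clD (i := i') (q := p')); do ?exact: repmod_fg.
split=> [x y|y|y].
- by rewrite !iE; apply: inji.
- by exists (s y); rewrite pE sK.
- rewrite pE pP iP.
  by split=> -[x <-]; exists x; rewrite iE.
Qed.

Lemma class_zero (X : rep A) : dim X = 0%N -> cl (repmod X) = 0.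
Proof.
move=> dX.
have st0 : stable (0%VS : {vspace X}).
  by move=> a x; rewrite !memv0 => /eqP ->; rewrite linear0.
have X0 (x : X) : x = 0.
  apply/eqP; rewrite -memv0; suff -> : 0%VS = fullv :> {vspace X} by rewrite memvf.
  by apply/eqP; rewrite eq_sym -dimv_eq0 dimvf dX.
have E := class_sub_quo st0.
have [i [/repmod_linear[i' iE] inji iP]] := subrep_in st0.
have bi : bijective i'.
  exists (fun x => 0) => x; last by rewrite [LHS]X0 [RHS]X0.
  by apply: inji; rewrite [LHS]X0 [RHS]X0.
have [p [s [/repmod_linear[p' pE] sK pP _]]] := quorep_out st0.
have bp : bijective p'.
  by exists s => x; [rewrite [LHS]X0 [RHS]X0 | rewrite pE sK].
move: E; rewrite (class_iso bi (repmod_fg _)) -(class_iso bp (repmod_fg _)).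
by move/(congr1 (fun y => y - cl (repmod X))); rewrite subrr addrK => /esym.
Qed.

End Classes.

Lemma rep_iso_trace (X Y : rep A) c : rep_iso X Y ->
  lftr (act X c) = lftr (act Y c).
Proof.
move=> [f [fA [g fK gK]]].
have f0 : lker f == 0%VS by apply/lker0P/(can_inj fK).
have -> : act X c = (f^-1 \o (act Y c \o f))%VF.
  by apply/lfunP => x; rewrite !comp_lfunE -fA lker0_lfunK.
rewrite lftrC; congr lftr; apply/lfunP => y; rewrite !comp_lfunE.
by rewrite -[y]gK lker0_lfunK.
Qed.

(** Every class is a combination of classes of irreducibles [S j]; the elements
    [a j] dual to the irreducible characters read off its coefficients, which
    only matter in [K]. *)
Lemma class_formula (G : lmodType K) (cl : lmodType A -> G) :
  exact_additive (@finitely_generated A) cl -> rep_split A ->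
  exists m (a : 'I_m -> A) (s : 'I_m -> G), forall X : rep A,
    cl (repmod X) = \sum_j lftr (act X (a j)) *: s j.
Proof.
move=> clD splitA.
have [m [S [irrS nisoS complS]]] := complete_irreducibles splitA.
pose a t := projT1 (cid (dual_traces splitA irrS nisoS t)).
have aE j t : lftr (act (S j) (a t)) = (j == t)%:R by rewrite /a; case: cid.
exists m, a, (fun j => cl (repmod (S j))) => X.
have [N] := ubnP (dim X); elim: N X => // N IHN X; rewrite ltnS => leN.
have [dX|dX] := eqVneq (dim X) 0%N.
  rewrite (class_zero clD dX) big1 // => j _.
  suff -> : act X (a j) = 0 by rewrite lftr0 scale0r.
  apply/lfunP => x; apply/eqP; rewrite zero_lfunE -memv0.
  suff -> : 0%VS = fullv :> {vspace X} by rewrite memvf.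
  by apply/eqP; rewrite eq_sym -dimv_eq0 dimvf dX.
have [irrX|] := pselect (irreducible X).
  have [t [f [fA bf]]] := complS X irrX.
  have [g gE] := repmod_linear fA.
  have bg : bijective g by case: bf => f' fK f'K; exists f' => x; rewrite gE ?fK ?f'K.
  have trE j : lftr (act X (a j)) = (t == j)%:R.
    by rewrite -aE; apply/esym/rep_iso_trace; exists f.
  rewrite -(class_iso clD bg (repmod_fg _)) (bigD1 t) //= big1 => [|j jt].
    by rewrite trE eqxx scale1r addr0.
  by rewrite trE eq_sym (negPf jt) scale0r.
move=> nirr.
have [U [stU U0 Uf]] : exists U : {vspace X}, [/\ stable U, U <> 0%VS & U <> fullv].
  apply: contrapT => nU; apply: nirr; split=> // U stU.
  have [U0|U0] := pselect (U = 0%VS); [by left | right].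
  by apply: contrapT => Uf; apply: nU; exists U.
have dU : (0 < \dim U < dim X)%N.
  rewrite lt0n dimv_eq0; apply/andP; split; first exact/eqP.
  rewrite -dimvf ltn_neqAle dimvS ?subvf // andbT; apply/eqP => dE.
  by apply: Uf; apply/eqP; rewrite eqEdim subvf dE /=.
rewrite (class_sub_quo clD stU) !IHN.
- by rewrite -big_split; apply: eq_bigr => j _; rewrite (lftr_sub_quo stU) scalerDl.
- apply: leq_trans leN; have -> : dim (quorep stU) = \dim U^C by [].
  case/andP: dU => U_gt0 _; rewrite dimv_compl dimvf ltn_subrL U_gt0 lt0n.
  exact: dX.
- by apply: leq_trans leN; case/andP: dU.
Qed.

(** The character of a projective module is some [trmul _ b], so under this
    hypothesis all such characters are proportional, and with them the classes
    of projectives in [G_0 (x) K]. *)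
Lemma cartan_rank_le1 (K0K G0K : vectType K) (CK : 'Hom(K0K, G0K)) :
  rep_split A ->
  (forall a, exists c, forall b, trmul a b = c * trmul 1 b) ->
  cartan_map A CK -> (\dim (limg CK) <= 1)%N.
Proof.
move=> splitA rk1.
move=> [K0 [G0 [clK [clG [C [tK [tG [[grK grG CclK] [extK _ CKE]]]]]]]]].
have clD : exact_additive (@finitely_generated A) (fun M => tG (clG M) : G0K).
  move=> M N P i q fM fN fP ex; rewrite -raddfD; congr (tG _).
  exact: (grG.1 M N P i q).
have [m [a [s clE]]] := class_formula clD splitA.
pose c j := projT1 (cid (rk1 (a j))).
have cE j b : trmul (a j) b = c j * trmul 1 b by rewrite /c; case: cid.
pose v := \sum_j c j *: s j.
have projcl P : fg_projective P -> tG (clG P) \in <[v]>%VS.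
  move=> fpP; have [X [f bf]] := fg_repmod fpP.1.
  have [b bE] := projective_trace bf fpP.
  rewrite -(class_iso clD bf (repmod_fg _)) clE; apply/vlineP.
  exists (trmul 1 b); rewrite scaler_sumr.
  by apply: eq_bigr => j _; rewrite bE cE scalerA mulrC.
(* [pr] kills all classes of projectives, hence the whole image of [CK]. *)
pose pr : 'End(G0K) := (\1 - projv <[v]>)%VF.
have prv x : x \in <[v]>%VS -> pr x = 0.
  by move=> xv; rewrite add_lfunE opp_lfunE id_lfunE projv_id // subrr.
have prC x : pr (tG (C x)) = 0.
  pose z : {additive K0 -> G0K} := \0.
  have zex : exact_additive (@fg_projective A) (fun=> 0 : G0K).
    by move=> *; rewrite addr0.
  have [_ uniq] := grK.2 _ _ zex.
  apply: (uniq (pr \o (tG \o C) : {additive K0 -> G0K}) z) => // P fpP /=.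
  by rewrite CclK // prv // projcl.
have prCK : (fun x => pr (CK x)) =1 (fun=> 0).
  have [|_ uniq] := extK.2 G0K \0; first by move=> *; rewrite scaler0.
  apply: (uniq (pr \o CK : {linear K0K -> G0K}) \0) => x //=.
  by rewrite CKE prC.
have : (limg CK <= <[v]>)%VS.
  apply/subvP => _ /memv_imgP[x _ ->]; have := prCK x.
  rewrite add_lfunE opp_lfunE id_lfunE => /eqP; rewrite subr_eq0 => /eqP ->.
  exact: memv_proj.
by move=> /dimvS/leq_trans; apply; rewrite dim_vline leq_b1.
Qed.

End Modules.

(** * Blocks *)

(** A nonzero stable subspace of least dimension is irreducible. *)
Lemma irreducible_subrep (K : fieldType) (A : falgType K) (X : rep A)
    (V : {vspace X}) : stable V -> V <> 0%VS ->
  exists (L : {vspace X}) (stL : stable L),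
    (L <= V)%VS /\ irreducible (subrep stL).
Proof.
move=> stV V0.
pose P n := `[< exists L : {vspace X},
  [/\ stable L, (L <= V)%VS, \dim L = n & n <> 0%N] >].
have P0 : exists n, P n.
  exists (\dim V); apply/asboolP; exists V; split=> // /eqP.
  by rewrite dimv_eq0 => /eqP.
case: (ex_minnP P0) => n /asboolP[L [stL LV dL n0]] minn.
exists L, stL; split=> //; split; first by rewrite [dim _]dL; apply/eqP.
move=> U stU; have [i [iA inji iP]] := subrep_in stL.
have stW : stable (i @: U).
  by move=> a _ /memv_imgP[x xU ->]; rewrite -iA memv_img ?stU.
have WL : (i @: U <= L)%VS by apply/subvP => _ /memv_imgP[x _ ->]; apply/iP; exists x.
have dW : \dim (i @: U) = \dim U.
  apply: limg_dim_eq; have /eqP-> : lker i == 0%VS by apply/lker0P.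
  by rewrite capv0.
have [U0|U0] := eqVneq (\dim U) 0%N; [left|right].
  by apply/eqP; rewrite -dimv_eq0 U0.
apply/eqP; rewrite eqEdim subvf dimvf [dim _]dL -dW; apply: minn.
apply/asboolP; exists (i @: U)%VS; split=> //; first exact: subv_trans LV.
by rewrite dW; apply/eqP.
Qed.

Section Block.
Variables (K : fieldType) (A : falgType K).

Fact regular_actM (a b : A) : amull (a * b) = (amull a \o amull b)%VF.
Proof. by apply/lfunP => x; rewrite comp_lfunE !lfunE /= mulrA. Qed.
Fact regular_act_linear : linear (@amull K A).
Proof.
move=> k a b; apply/lfunP => x.
by rewrite add_lfunE scale_lfunE !lfunE /= mulrDl scalerAl.
Qed.
Definition regular : rep A := Rep (@amull1 K A) regular_actM regular_act_linear.

Variable U : {aspace A}.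
Hypothesis blockU : indecomposable_ideal U.

Let e := algid U.
Let U_l a u : u \in U -> a * u \in U.
Proof.
by move=> uU; have [[/subvP UU _] _ _] := blockU; apply/UU/memv_mul; rewrite ?memvf.
Qed.
Let U_r a u : u \in U -> u * a \in U.
Proof.
by move=> uU; have [[_ /subvP UU] _ _] := blockU; apply/UU/memv_mul; rewrite ?memvf.
Qed.
Let eU : e \in U. Proof. exact: memv_algid. Qed.
Let eul u : u \in U -> e * u = u. Proof. exact: algidl. Qed.
Let eur u : u \in U -> u * e = u. Proof. exact: algidr. Qed.
Let eC a : e * a = a * e.
Proof. by rewrite -(eur (U_r a eU)) -mulrA eul ?U_l. Qed.

(** For large [N] the kernel and the image of [y ^+ N] on [U] are ideals with
    direct sum [U] (Fitting), so one of them is zero; [x] lies in the kernel. *)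
Lemma central_nilpotent y x : (forall a, y * a = a * y) ->
  x \in U -> x != 0 -> y * x = 0 -> exists N, forall u, u \in U -> y ^+ N * u = 0.
Proof.
move=> yC xU x0 yx.
have yNC N a : y ^+ N * a = a * y ^+ N by exact: esym (commrX N (esym (yC a))).
pose D N := \dim (amull (y ^+ N) @: U).
have [M minM] : exists M, forall N, (D M <= D N)%N.
  pose P n := `[< exists N, D N = n >].
  have P0 : exists n, P n by exists (D 0); apply/asboolP; exists 0%N.
  case: (ex_minnP P0) => n /asboolP[M DM] minn; exists M => N.
  by rewrite DM; apply: minn; apply/asboolP; exists N.
have imgS k N : (amull (y ^+ k) @: (amull (y ^+ N) @: U) =
    amull (y ^+ (k + N)) @: U)%VS.
  by rewrite -limg_comp -regular_actM -exprD.
have DS N : (D N.+1 <= D N)%N.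
  rewrite /D -[N.+1]add1n -imgS.
  by rewrite -[leqRHS](limg_ker_dim (amull (y ^+ 1))) leq_addl.
(* The exponent [M.+1] is positive, so that [y ^+ M.+1] kills [x]. *)
exists M.+1; set g := amull (y ^+ M.+1).
pose W1 := (U :&: lker g)%VS; pose W2 := (g @: U)%VS.
have W12 : (W1 :&: W2 = 0)%VS.
  apply/eqP; rewrite -subv0 /W1; apply: subv_trans (capvS (capvSr _ _) (subvv _)) _.
  rewrite capvC subv0 -dimv_eq0 -leqn0 -(leq_add2r (\dim (g @: W2))).
  rewrite limg_ker_dim add0n imgS; apply: leq_trans (DS M) _; exact: minM.
have W2U : (W2 <= U)%VS.
  by apply/subvP => _ /memv_imgP[u uU ->]; rewrite lfunE /= U_l.
have sumW : (W1 + W2)%VS = U.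
  apply/eqP; rewrite eqEdim subv_add capvSl W2U /=.
  by rewrite dimv_disjoint_sum // limg_ker_dim.
have [_ _ indU] := blockU.
have W1E u : (u \in W1) = (u \in U) && (y ^+ M.+1 * u == 0).
  by rewrite memv_cap memv_ker lfunE.
have idW1 : two_sided_ideal W1.
  split; apply/prodvP => a b.
    move=> _; rewrite !W1E => /andP[bU /eqP yb].
    by rewrite U_l //= mulrA yNC -mulrA yb mulr0 eqxx.
  rewrite W1E => /andP[aU /eqP ya] _.
  by rewrite W1E U_r //= mulrA ya mul0r eqxx.
have idW2 : two_sided_ideal W2.
  split; apply/prodvP => a b.
    move=> _ /memv_imgP[u uU ->]; rewrite lfunE /= mulrA -yNC -mulrA.
    by have := memv_img g (U_l a uU); rewrite lfunE.
  move=> /memv_imgP[u uU ->] _; rewrite lfunE /= -mulrA.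
  by have := memv_img g (U_r b uU); rewrite lfunE.
have [W10|W20] := indU _ _ idW1 idW2 sumW W12.
  case/eqP: x0; apply/eqP; rewrite -memv0 -W10 W1E xU.
  by rewrite exprSr -mulrA yx mulr0 /=.
move=> u uU; have := memv_img g uU; rewrite -/W2 W20 memv0 lfunE.
by move/eqP.
Qed.

(** A central element acts by a scalar on a minimal left ideal contained in
    [U], hence by that scalar plus a nilpotent on [U]. *)
Lemma central_scalar z : rep_split A -> (forall a, z * a = a * z) ->
  exists c, forall b, b \in U -> trmul z b = c * trmul e b.
Proof.
move=> splitA zC.
have stU : stable (U : {vspace regular}).
  by move=> a x xU; rewrite lfunE /= U_l.
have [|L [stL [LU irrL]]] := irreducible_subrep stU; first by case: blockU.
have [|c cE] := splitA _ (act (subrep stL) z) irrL.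
  by move=> a x; rewrite -!actME zC.
have [i [iA inji iP]] := subrep_in stL.
pose w := vpick {:subrep stL}; pose x := i w.
have w0 : w != 0 by rewrite vpick0 -dimv_eq0 dimvf; case: irrL.
have x0 : x != 0 by apply: contra w0 => /eqP x0; apply/eqP/inji; rewrite linear0.
have xU : x \in U by apply: (subvP LU); apply/iP; exists w.
pose y := z - c%:A.
have yC a : y * a = a * y.
  by rewrite mulrBl mulrBr zC -scalerAl -scalerAr mul1r mulr1.
have yx : y * x = 0.
  rewrite mulrBl -scalerAl mul1r; have := iA z w; rewrite cE linearZ /= lfunE /=.
  by move=> <-; rewrite subrr.
have [N yN] := central_nilpotent yC xU x0 yx.
exists c => b bU; rewrite /trmul.
have -> : (amull z \o amulr b = c *: (amull e \o amulr b) + (amull y \o amulr b))%VF.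
  apply/lfunP => t; rewrite add_lfunE scale_lfunE !comp_lfunE !lfunE /=.
  by rewrite eul ?U_l // mulrBl -scalerAl mul1r addrC subrK.
(* The power [N.+1] makes [b ^+ N.+1] an element of [U], on which [y ^+ N] is 0. *)
rewrite lftrD lftrZ [X in _ + X](@lftr_nilp _ N.+1) ?addr0 // => t.
have E k : iter k (amull y \o amulr b)%VF t = y ^+ k * (t * b ^+ k).
  elim: k => [|k IHk]; first by rewrite !expr0 mul1r mulr1.
  rewrite iterS IHk comp_lfunE !lfunE /= !mulrA exprS exprSr !mulrA.
  by congr (_ * _); rewrite -!mulrA.
rewrite E exprSr -mulrA yN ?mulr0 // U_l // U_l // exprSr U_l //.
Qed.

Definition to_block (a : A) : subvs_of U := vsproj U (e * a).

Lemma val_to_block a : val (to_block a) = e * a.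
Proof. by rewrite /= vsprojK ?U_r. Qed.
Lemma to_blockK u : to_block (val u) = u.
Proof. by apply: val_inj; rewrite val_to_block eul ?subvsP. Qed.
Lemma to_blockM a b : to_block (a * b) = to_block a * to_block b.
Proof.
apply: val_inj; rewrite [RHS]/= !val_to_block !mulrA -(eC (e * a)).
by rewrite [in RHS]mulrA (eul eU).
Qed.
Lemma to_block1 : to_block 1 = 1.
Proof. by apply: val_inj; rewrite val_to_block mulr1. Qed.
Lemma to_block_linear : linear to_block.
Proof.
by move=> k a b; rewrite /to_block mulrDr -scalerAr linearP.
Qed.

(** Along [to_block] an irreducible representation of the block becomes one of
    [A], with the same endomorphisms. *)
Lemma block_split : rep_split A -> rep_split (subvs_of U).
Proof.
move=> splitA X f [dX irrX] fA; pose inf a := act X (to_block a).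
have inf1 : inf 1 = \1%VF by rewrite /inf to_block1 act1.
have infM a b : inf (a * b) = (inf a \o inf b)%VF by rewrite /inf to_blockM actM.
have infl : linear inf by move=> k a b; rewrite /inf to_block_linear linearP.
apply: (splitA (Rep inf1 infM infl)); last by move=> a x; apply: fA.
split=> // V stV; apply: irrX => u x xV.
by rewrite -[u]to_blockK; apply: (stV (val u)).
Qed.

Lemma block_trmul (a b : subvs_of U) :
  trmul a b = trmul (val a) (val b).
Proof.
pose j : 'Hom(subvs_of U, A) := linfun (@vsval K A U).
have ppl := to_block_linear.
pose pl : {linear A -> subvs_of U} := HB.pack to_block
  (GRing.isLinear.Build K A (subvs_of U) _ _ ppl).
have -> : trmul (val a) (val b) =
    lftr (j \o ((amull a \o amulr b) \o linfun pl))%VF.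
  congr lftr; apply/lfunP => x; rewrite !comp_lfunE !lfunE /=.
  by rewrite vsprojK ?U_r // !mulrA eur ?subvsP.
rewrite /trmul [RHS]lftrC; congr lftr; apply/lfunP => x.
by rewrite !comp_lfunE !lfunE /= [to_block _]to_blockK.
Qed.

Lemma block_rank1 : rep_split A ->
  (forall a : A, exists z : A, (forall b, z * b = b * z) /\
     forall b, trmul a b = trmul z b) ->
  forall a : subvs_of U, exists c, forall b : subvs_of U,
    trmul a b = c * trmul 1 b.
Proof.
move=> splitA centA a; have [z [zC zE]] := centA (val a).
have [c cE] := central_scalar splitA zC; exists c => b.
by rewrite !block_trmul zE cE // subvsP.
Qed.

End Block.

(** * Trace functions on central simple algebras *)

Section CentralSimple.
Variables (F : fieldType) (Q : falgType F).
Hypothesis csQ : central_simple Q.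
Hypothesis dimQ : (dim Q)%:R != 0 :> F.

Definition ltrace (x : Q) : F := lftr (amull x).

Lemma ltrace_linear : linear (ltrace : Q -> F^o).
Proof. by move=> k x y; rewrite /ltrace (@regular_act_linear F Q) lftrD lftrZ. Qed.
HB.instance Definition _ := GRing.isLinear.Build F Q F^o _ ltrace ltrace_linear.

Lemma ltraceC x y : ltrace (x * y) = ltrace (y * x).
Proof. by rewrite /ltrace !(@regular_actM F Q) lftrC. Qed.
Lemma ltrace1 : ltrace 1 = (dim Q)%:R.
Proof. by rewrite /ltrace amull1 lftr1. Qed.

(** The radical of the form [ltrace (x * y)] is an ideal not containing [1],
    so the form is nondegenerate and [f = ltrace (u * _)]; then [u] is central. *)
Lemma trace_function_unique (f : {linear Q -> F^o}) :
  (forall x y : Q, f (x * y) = f (y * x)) ->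
  exists c, forall x, f x = c * ltrace x.
Proof.
move=> fC; pose N := \dim {:Q}; pose b : N.-tuple Q := vbasis {:Q}.
have bb : basis_of fullv b := vbasisP {:Q}.
have gl : linear (fun x : Q => \sum_(i < N) ltrace (x * b`_i) *: b`_i).
  move=> k x y; rewrite scaler_sumr -big_split; apply: eq_bigr => i _ /=.
  by rewrite mulrDl -scalerAl ltrace_linear scalerDl scalerA.
pose g : {linear Q -> Q} := HB.pack
  (fun x : Q => \sum_(i < N) ltrace (x * b`_i) *: b`_i)
  (GRing.isLinear.Build F Q Q _ _ gl).
have gP x (h : {linear Q -> F^o}) : linfun g x = \sum_(i < N) h b`_i *: b`_i ->
    forall y, ltrace (x * y) = h y.
  rewrite lfunE /= => /(congr1 (fun z i => coord b i z)) E y.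
  have {}E (i : 'I_N) : ltrace (x * b`_i) = h b`_i.
    by have := congr1 (@^~ i) E; rewrite !coord_sum_free ?(basis_free bb).
  rewrite (coord_basis bb (memvf y)) mulr_sumr !linear_sum.
  by apply: eq_bigr => i _; rewrite -scalerAr !linearZ /= E.
have kerP x : reflect (forall y, ltrace (x * y) = 0) (x \in lker (linfun g)).
  rewrite memv_ker; apply: (iffP eqP) => [gx y|x0].
    rewrite (gP x \0) // gx big1 // => i _; exact: scale0r.
  by rewrite lfunE /= big1 // => i _; rewrite x0 scale0r.
have ker0 : lker (linfun g) == 0%VS.
  have [|/eqP //|kf] := csQ.2 (lker (linfun g)).
    split; apply/prodvP => x y.
      by move=> _ /kerP y0; apply/kerP => z; rewrite -mulrA ltraceC -mulrA y0.
    by move=> /kerP x0 _; apply/kerP => z; rewrite -mulrA x0.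
  have /kerP/(_ 1) : (1 : Q) \in lker (linfun g) by rewrite kf memvf.
  by rewrite mulr1 ltrace1 => /eqP; rewrite (negPf dimQ).
have /memv_imgP[u _ /esym/gP uP] :
    \sum_(i < N) f b`_i *: b`_i \in limg (linfun g).
  by rewrite (lker0_limgf ker0); apply: memvf.
have : u \in 'Z({:Q})%VS.
  rewrite memv_cap memvf; apply/centvP => y _.
  apply/eqP; rewrite -subr_eq0 -memv0 -(eqP ker0); apply/kerP => z.
  rewrite mulrBl linearB /= -mulrA uP -mulrA ltraceC -mulrA uP.
  by rewrite fC subrr.
rewrite csQ.1 => /vlineP[c uc]; exists c => x.
by rewrite -uP uc -scalerAl mul1r linearZ.
Qed.

(** A functional vanishing on all commutators is a multiple of [ltrace], so
    the commutators span the kernel of [ltrace]. *)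
Lemma ltrace0_commutators n (w : 'I_n -> Q) x :
  (forall y, exists c : 'I_n -> F, y = \sum_i c i *: w i) -> ltrace x = 0 ->
  exists c : 'I_n -> 'I_n -> F,
    x = \sum_i \sum_j c i j *: (w i * w j - w j * w i).
Proof.
move=> wP x0; have [||C CP] := @vspace_of_closed F Q (fun y =>
    exists c : 'I_n -> 'I_n -> F,
    y = \sum_i \sum_j c i j *: (w i * w j - w j * w i)).
- exists (fun _ _ => 0); rewrite big1 // => i _.
  by rewrite big1 // => j _; rewrite scale0r.
- move=> k _ _ [c ->] [d ->]; exists (fun i j => k * c i j + d i j).
  rewrite scaler_sumr -big_split; apply: eq_bigr => i _ /=.
  rewrite scaler_sumr -big_split; apply: eq_bigr => j _ /=.
  by rewrite scalerDl scalerA.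
apply/CP; have wwC i j : w i * w j - w j * w i \in C.
  apply/CP; exists (fun k l => ((k == i) && (l == j))%:R).
  rewrite (bigD1 i) //= (bigD1 j) //= !eqxx scale1r big1 => [|l /negPf->].
    rewrite addr0 big1 ?addr0 // => k /negPf ki.
    by rewrite big1 // => l _; rewrite ki scale0r.
  by rewrite scale0r.
pose p := (\1 - projv C)%VF.
have pC y : y \in C -> p y = 0.
  by move=> yC; rewrite add_lfunE opp_lfunE id_lfunE projv_id ?subrr.
suff px : p x = 0.
  move: px; rewrite add_lfunE opp_lfunE id_lfunE => /eqP.
  by rewrite subr_eq0 => /eqP ->; apply: memv_proj.
pose N := \dim {:Q}; pose b : N.-tuple Q := vbasis {:Q}.
rewrite [p x](coord_vbasis (memvf _)) big1 // => k _.
have hl : linear (fun y => coord b k (p y) : F^o).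
  by move=> a y z; rewrite !linearP.
pose h : {linear Q -> F^o} := HB.pack (fun y => coord b k (p y) : F^o)
  (GRing.isLinear.Build F Q F^o _ _ hl).
have [|c hc] := trace_function_unique (f := h).
  move=> y z; apply/eqP; rewrite -subr_eq0 -linearB /=.
  suff -> : p (y * z - z * y) = 0 by rewrite linear0.
  apply: pC; have [c ->] := wP y.
  rewrite mulr_suml mulr_sumr -sumrB rpred_sum // => i _.
  have [d ->] := wP z; rewrite mulr_suml mulr_sumr -sumrB rpred_sum // => j _.
  by rewrite -!scalerAl -!scalerAr !scalerA mulrC -scalerBr rpredZ.
have -> : coord b k (p x) = 0 by rewrite -[LHS]/(h x) hc x0 mulr0.
exact: scale0r.
Qed.

End CentralSimple.

(** * Traces preserving a lattice are integral *)

Section IntegralTrace.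
Variables (D : comNzRingType) (F : fieldType) (iota : {rmorphism D -> F}).

(** The characteristic polynomial of [E] is monic and vanishes at [t]. *)
Lemma integral_eigenvalue (T : finType) (x : T -> F) (E : T -> T -> D) t s0 :
  x s0 != 0 -> (forall s, t * x s = \sum_r iota (E s r) * x r) ->
  integralOver iota t.
Proof.
move=> x0 tE; pose M : 'M[D]_#|T| := \matrix_(i, j) E (enum_val j) (enum_val i).
exists (char_poly M); first exact: char_poly_monic.
rewrite map_char_poly -eigenvalue_root_char; apply/eigenvalueP.
exists (\row_j x (enum_val j)).
  apply/rowP => j; rewrite !mxE tE (reindex _ (onW_bij _ (@enum_val_bij T))) /=.
  by apply: eq_bigr => i _; rewrite !mxE mulrC.
apply: contra x0 => /eqP/rowP/(_ (enum_rank s0)).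
by rewrite !mxE enum_rankK => ->.
Qed.

(** If the rows of [V] span and [M] maps each of them to an integral
    combination of all, then [\tr M] times an [N]-minor of [V] is the sum of the
    minors obtained by applying [M] to one of its rows, hence an integral
    combination of [N]-minors; and some [N]-minor is nonzero. *)
Lemma integral_trace n N (V : 'M[F]_(n, N)) (M : 'M[F]_N) (A : 'M[D]_n) :
  row_full V -> V *m M = map_mx iota A *m V -> integralOver iota (\tr M).
Proof.
move=> fV VM.
pose x (s : {ffun 'I_N -> 'I_n}) := \det (rowsub s V).
pose upd (s : {ffun 'I_N -> 'I_n}) k j := [ffun i => if i == k then j else s i].
pose E (s r : {ffun 'I_N -> 'I_n}) : D :=
  \sum_k \sum_(j | upd s k j == r) A (s k) j.
apply: (@integral_eigenvalue _ x E _ (fullrankfun fV)).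
  by have := fullrowsub_unit fV; rewrite unitmxE unitfE.
move=> s.
have -> : \sum_r iota (E s r) * x r =
    \sum_k \sum_j iota (A (s k) j) * x (upd s k j).
  under eq_bigr do rewrite rmorph_sum mulr_suml.
  rewrite exchange_big; apply: eq_bigr => k _ /=.
  under eq_bigr do rewrite rmorph_sum mulr_suml.
  rewrite (exchange_big_dep xpredT) //=; apply: eq_bigr => j _.
  by rewrite (big_pred1 (upd s k j)) // => r /=; rewrite eq_sym.
pose P := rowsub s V.
have -> : \tr M * x s = \sum_k \sum_j (P *m M) k j * cofactor P k j.
  transitivity (\tr (P *m M *m \adj P)).
    by rewrite mxtrace_mulC mulmxA mul_adj_mx mul_scalar_mx linearZ /= mulrC.
  by apply: eq_bigr => k _; rewrite mxE; apply: eq_bigr => j _; rewrite [\adj _ _ _]mxE.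
apply: eq_bigr => k _.
have PM l : (P *m M) k l = \sum_j iota (A (s k) j) * V j l.
  transitivity ((V *m M) (s k) l).
    by rewrite !mxE; apply: eq_bigr => i _; rewrite mxE.
  by rewrite VM mxE; apply: eq_bigr => j _; rewrite mxE.
transitivity (\sum_j iota (A (s k) j) * \sum_l V j l * cofactor P k l).
  under eq_bigr do rewrite PM mulr_suml.
  rewrite exchange_big; apply: eq_bigr => j _ /=.
  by rewrite mulr_sumr; apply: eq_bigr => l _; rewrite mulrA.
apply: eq_bigr => j _; congr (_ * _); rewrite /x (expand_det_row _ k).
apply: eq_bigr => l _; rewrite mxE ffunE eqxx; congr (_ * _).
congr (_ * \det _); apply/matrixP => a b; rewrite !mxE ffunE.
by rewrite eq_sym (negPf (neq_lift _ _)).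
Qed.

End IntegralTrace.

(** * Prime rings that are free over a central subring *)

Section FreeTrace.
Variables (R : comNzRingType) (H : algType R) (n : nat).
Variables (v : {linear H -> 'rV[R]_n}) (w : 'I_n -> H).
Hypothesis basisP : forall h, h = \sum_i v h 0 i *: w i.

(** The trace of [x |-> a * x * b]. *)
Definition frtrace (a b : H) : R := \sum_i v (a * w i * b) 0 i.

Lemma frtraceZr r a b : frtrace a (r *: b) = r * frtrace a b.
Proof.
by rewrite /frtrace mulr_sumr; apply: eq_bigr => i _; rewrite -scalerAr linearZ mxE.
Qed.

Lemma frtraceBl a a' b : frtrace (a - a') b = frtrace a b - frtrace a' b.
Proof.
rewrite /frtrace -sumrB; apply: eq_bigr => i _.
by rewrite !mulrBl linearB !mxE.
Qed.

Lemma frtrace_suml I r (P : pred I) (f : I -> H) b :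
  frtrace (\sum_(i <- r | P i) f i) b = \sum_(i <- r | P i) frtrace (f i) b.
Proof.
rewrite /frtrace exchange_big; apply: eq_bigr => j _ /=.
by rewrite !mulr_suml linear_sum summxE.
Qed.

Lemma frtraceC x y b : frtrace (x * y) b = frtrace (y * x) b.
Proof.
have E s t : frtrace (s * t) b =
    \sum_i \sum_j v (t * w i * b) 0 j * v (s * w j) 0 i.
  apply: eq_bigr => i _; rewrite -mulrA -mulrA [t * _]mulrA.
  rewrite [t * w i * b in LHS]basisP mulr_sumr linear_sum summxE.
  by apply: eq_bigr => j _; rewrite -scalerAr linearZ mxE.
have E' s t : frtrace (s * t) b =
    \sum_i \sum_j v (t * w i) 0 j * v (s * w j * b) 0 i.
  apply: eq_bigr => i _; rewrite -[s * t * _]mulrA.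
  rewrite [t * w i in LHS]basisP mulr_sumr mulr_suml linear_sum summxE.
  by apply: eq_bigr => j _; rewrite -scalerAr -scalerAl linearZ mxE.
rewrite E E' exchange_big; apply: eq_bigr => i _; apply: eq_bigr => j _.
by rewrite mulrC.
Qed.

Lemma frtrace_centralM (s a b : H) : (forall h, s * h = h * s) ->
  frtrace (s * a) b = frtrace a (s * b).
Proof.
move=> sC; apply: eq_bigr => i _; suff -> : s * a * w i * b = a * w i * (s * b) by [].
by rewrite mulrA -(sC (a * w i)) mulrA.
Qed.

(** By Cayley-Hamilton [s] is a root of a monic polynomial over [R]; dividing
    by ['X] until the constant term is nonzero exhibits a multiple of [s]. *)
Lemma central_regular_divides (s : H) : (forall h, s * h = h * s) ->
  (forall h, s * h = 0 -> h = 0) -> exists r h, r <> 0 /\ s * h = r%:A.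
Proof.
move=> sC sreg.
have [p p0 ps] : exists2 p : {poly R}, p != 0 & horner_alg s p = 0.
  have H1 : (1 : H) != 0 := oner_neq0 H.
  case: n v w basisP => [v0 w0 b0|n' v0 w0 b0].
    by case/eqP: H1; rewrite [LHS]b0 big_ord0.
  pose M : 'M[R]_n'.+1 := \matrix_(i, j) v0 (s * w0 i) 0 j.
  have vM h : v0 (s * h) = v0 h *m M.
    rewrite [in LHS](b0 h) mulr_sumr linear_sum; apply/rowP => j.
    rewrite mxE summxE; apply: eq_bigr => i _.
    by rewrite -scalerAr linearZ !mxE.
  have vp p h : v0 (horner_alg s p * h) = v0 h *m horner_mx M p.
    elim/poly_ind: p h => [|p c IHp] h.
      by rewrite !rmorph0 mul0r mulmx0 linear0.
    rewrite !rmorphD !rmorphM /= horner_algX horner_algC horner_mx_X horner_mx_C.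
    rewrite mulrDl mulmxDr linearD -mulrA IHp vM -mulmxA.
    rewrite -scalerAl mul1r linearZ /= mul_mx_scalar; congr (_ *m _ + _).
    have : horner_mx M ('X * p) = horner_mx M (p * 'X) by rewrite mulrC.
    by rewrite !rmorphM /= horner_mx_X.
  exists (char_poly M); first exact: monic_neq0 (char_poly_monic M).
  rewrite -[LHS]mulr1 [LHS]b0 big1 // => i _.
  by rewrite vp Cayley_Hamilton mulmx0 mxE scale0r.
elim/poly_ind: p p0 ps => [|p c IHp]; first by rewrite eqxx.
rewrite rmorphD rmorphM /= horner_algX horner_algC => pc0.
have [c0|c0] := eqVneq c 0.
  rewrite c0 scale0r addr0 -sC => /sreg ps; apply: IHp => //.
  by apply: contra pc0 => /eqP->; rewrite c0 mul0r add0r.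
move=> /eqP; rewrite -sC addrC addr_eq0 => /eqP pcs.
exists c, (- horner_alg s p); split; first exact/eqP.
by rewrite mulrN pcs.
Qed.

End FreeTrace.

Section PrimeFree.
Variables (R : comNzRingType) (H : algType R) (H_prime : prime_ring H).
Variables (n : nat) (v : {linear H -> 'rV[R]_n}) (w : 'I_n -> H).
Hypothesis basisP : forall h, h = \sum_i v h 0 i *: w i.

Local Notation D := (prime_centre H_prime).
Local Notation F := {fraction D}.
Local Notation tofrac := (@FracField.tofrac D).

Definition of_centre (z : D) : H := val (z : centre H).

Fact of_centre_additive : additive of_centre. Proof. by []. Qed.
Fact of_centre_multiplicative : monoid_morphism of_centre. Proof. by []. Qed.
HB.instance Definition _ := GRing.isZmodMorphism.Build D H of_centre of_centre_additive.
HB.instance Definition _ := GRing.isMonoidMorphism.Build D H of_centre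
  of_centre_multiplicative.

Lemma of_centreC z h : of_centre z * h = h * of_centre z.
Proof. by have /centre_predP := valP (z : centre H). Qed.

Lemma of_centre_inj : injective of_centre.
Proof. by move=> x y /val_inj. Qed.

Lemma of_centre_reg z h : z != 0 -> of_centre z * h = 0 -> h = 0.
Proof.
move=> z0 zh; have [x|ze|//] := @H_prime (of_centre z) h.
  by rewrite of_centreC -mulrA zh mulr0.
by move: z0; rewrite (@of_centre_inj z 0 ze) eqxx.
Qed.

Fact alg_centre (r : R) : (r%:A : H) \in @centre_pred H.
Proof. by apply/centre_predP => h; rewrite -scalerAl -scalerAr mul1r mulr1. Qed.
Definition to_centre (r : R) : D := Centre (alg_centre r).

Lemma to_centreE r h : of_centre (to_centre r) * h = r *: h.
Proof. by rewrite /of_centre /= -scalerAl mul1r. Qed.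

(** If [J] indexes a maximal [D]-independent subfamily of [w], then a single
    [s != 0] multiplies all of [H] into the free module on [J].  Through the
    universal property of a scalar extension of [H] to [F], the resulting
    embedding shows that [H] injects into that extension. *)
Lemma torsion_free_embedding : exists f : {additive H -> 'rV[F]_n},
  (forall z h, f (of_centre z * h) = tofrac z *: f h) /\
  forall h, f h = 0 -> h = 0.
Proof.
pose comb (J : {set 'I_n}) (c : 'I_n -> D) := \sum_(j in J) of_centre (c j) * w j.
have combD J c d : comb J c + comb J d = comb J (fun j => c j + d j).
  by rewrite -big_split; apply: eq_bigr => j _; rewrite rmorphD mulrDl.
have combZ J z c : of_centre z * comb J c = comb J (fun j => z * c j).
  by rewrite mulr_sumr; apply: eq_bigr => j _; rewrite rmorphM mulrA.
pose indep J := `[< forall c, comb J c = 0 -> forall j, j \in J -> c j = 0 >].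
have [|J /maxsetP[/asboolP indJ maxJ]] := ex_maxset (P := indep).
  by exists set0; apply/asboolP => c _ j; rewrite inE.
have combI c d : comb J c = comb J d -> forall j, j \in J -> c j = d j.
  move=> /eqP; rewrite -subr_eq0 => /eqP cd j jJ; apply/eqP; rewrite -subr_eq0.
  apply/eqP; apply: (indJ (fun j => c j - d j)) => //.
  by rewrite -[RHS]cd /comb -sumrB; apply: eq_bigr => i _; rewrite rmorphB mulrBl.
have w_dep i : exists s, s != 0 /\ exists c, of_centre s * w i = comb J c.
  have [iJ|iJ] := boolP (i \in J).
    exists 1; split; first exact: oner_neq0.
    exists (fun j => (j == i)%:R); rewrite /comb (bigD1 i) //= eqxx big1 ?addr0 //.
    by move=> j /andP[_ /negPf->]; rewrite rmorph0 mul0r.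
  have /asboolPn : ~~ indep (i |: J).
    apply/negP => /maxJ iJE; case/negP: iJ; rewrite -iJE ?subsetUr //.
    by rewrite setU11.
  move=> ndep; have [c [cP [j jJ cj]]] : exists c, comb (i |: J) c = 0 /\
      exists2 j, j \in i |: J & c j <> 0.
    apply: contrapT => nc; apply: ndep => c cP j jJ; apply: contrapT => cj.
    by apply: nc; exists c; split=> //; exists j.
  rewrite /comb big_setU1 //= -/(comb J c) in cP.
  exists (c i); split.
    apply/eqP => ci; rewrite ci rmorph0 mul0r add0r in cP.
    by move: jJ cj; rewrite in_setU1 => /orP[/eqP->|/(indJ _ cP)].
  exists (fun j => - c j); apply/eqP; rewrite -subr_eq0 -[X in _ == X]cP.
  apply/eqP; congr (_ + _); rewrite /comb -sumrN.
  by apply: eq_bigr => k _; rewrite rmorphN mulNr opprK.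
pose sw i := projT1 (cid (w_dep i)).
have sw0 i : sw i != 0 by rewrite /sw; case: cid => s [].
have swP i : exists c, of_centre (sw i) * w i = comb J c.
  by rewrite /sw; case: cid => s [].
pose S := \prod_i sw i.
have S0 : S != 0 by apply/prodf_neq0.
have SP h : exists c, of_centre S * h = comb J c.
  rewrite [h]basisP mulr_sumr; apply: (big_ind (fun x => exists c, x = comb J c)).
  - exists (fun=> 0); rewrite /comb big1 // => j _; by rewrite rmorph0 mul0r.
  - by move=> _ _ [c ->] [d ->]; exists (fun j => c j + d j); rewrite combD.
  move=> i _; have [c cE] := swP i; rewrite -to_centreE /S (bigD1 i) //= mulrA.
  set z := \prod_(j | _) _; exists (fun j => to_centre (v h 0 i) * z * c j).
  rewrite -combZ -cE !mulrA -!rmorphM; congr (of_centre _ * _).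
  by rewrite mulrC [sw i * z]mulrC mulrA.
pose co h := projT1 (cid (SP h)).
have coP h : of_centre S * h = comb J (co h) by rewrite /co; case: cid.
pose g h : 'rV[F]_n := \row_j if j \in J then tofrac (co h j) else 0.
have gadd : additive g.
  move=> x y; apply/rowP => j; rewrite !mxE; case: ifP => jJ; last by rewrite subr0.
  rewrite -rmorphB; congr tofrac; apply: (combI _ (fun j => co x j - co y j)) => //.
  rewrite -coP mulrBr !coP; apply/eqP; rewrite subr_eq; apply/eqP.
  rewrite combD; apply: eq_bigr => i _; by rewrite subrK.
pose f : {additive H -> 'rV[F]_n} := HB.pack g
  (GRing.isZmodMorphism.Build H 'rV[F]_n g gadd).
exists f; split=> [z h|h].
  apply/rowP => j; rewrite !mxE; case: ifP => jJ; last by rewrite mulr0.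
  rewrite -rmorphM; congr tofrac; apply: (combI _ (fun j => z * co h j)) => //.
  by rewrite -coP -combZ -coP mulrA [in LHS]of_centreC mulrA.
move=> /rowP fh; apply: (of_centre_reg S0); rewrite coP /comb big1 // => j jJ.
have := fh j; rewrite !mxE jJ => /eqP; rewrite tofrac_eq0 => /eqP->.
by rewrite rmorph0 mul0r.
Qed.

End PrimeFree.

(** * Reduction to central elements *)

Lemma frac_denominator (D : idomainType) (x : {fraction D}) :
  exists s z : D, s != 0 /\ FracField.tofrac s * x = FracField.tofrac z.
Proof.
elim/quotW: x => x; exists \d_x, \n_x; split; first exact: denom_ratioP.
unlock FracField.tofrac; rewrite -[LHS]FracField.pi_mul; apply/eqmodP => /=.
rewrite FracField.equivfE /FracField.mulf /= !numden_Ratio;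
  rewrite ?mul1r ?oner_neq0 ?denom_ratioP //.
by rewrite mulr1.
Qed.

Lemma common_denominator (D : idomainType) (I : finType) (c : I -> {fraction D}) :
  exists s : D, s != 0 /\
    exists z : I -> D, forall i, FracField.tofrac s * c i = FracField.tofrac (z i).
Proof.
pose s i := projT1 (cid (frac_denominator (c i))).
have sP i : exists z, s i != 0 /\ FracField.tofrac (s i) * c i = FracField.tofrac z.
  by rewrite /s; case: cid.
exists (\prod_i s i); split; first by apply/prodf_neq0 => i _; case: (sP i) => ? [].
exists (fun i => (\prod_(j | j != i) s j) * projT1 (cid (sP i))) => i.
case: cid => z [_ zE] /=; rewrite (bigD1 i) //= !rmorphM /= -zE.
by rewrite mulrAC mulrC.
Qed.

Section CentralReduction.
Import VectorInternalTheory.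
Variables (R : comNzRingType) (H : algType R) (H_prime : prime_ring H).
Hypothesis R_sub_H : injective (fun r : R => r%:A : H).
Variables (n : nat) (v : {linear H -> 'rV[R]_n}) (w : 'I_n -> H).
Hypothesis basisP : forall h, h = \sum_i v h 0 i *: w i.

Local Notation D := (prime_centre H_prime).
Local Notation F := {fraction D}.
Local Notation tofrac := (@FracField.tofrac D).

Lemma scalar_reg (r x : R) : r <> 0 -> r * x = 0 -> x = 0.
Proof.
move=> r0 rx; have [h|rA|xA] := H_prime (a := r%:A) (b := x%:A).
- by rewrite -scalerAl mul1r -scalerAr mulr1 scalerA mulrC rx scale0r.
- by case: r0; apply: R_sub_H; rewrite /= rA scale0r.
- by apply: R_sub_H; rewrite /= xA scale0r.
Qed.

(** The central element is the trace of multiplication by [a] on the central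
    simple algebra [Q]. *)
Lemma central_reduction d : PI_degree H_prime d ->
  (exists u : H, d%:R * u = 1) -> integrally_closed D ->
  forall a : H, exists z : D, forall b,
    frtrace v w ((d ^ 2)%:R * a) b = frtrace v w (of_centre z) b.
Proof.
move=> [d_gt0 [Q [phi [[phiZ phiU] csQ dimQ]]]] [u du] icD a.
have {}phiZ z h : phi (of_centre z * h) = tofrac z *: phi h by exact: phiZ.
have phiR r h : phi (r *: h) = tofrac (to_centre H_prime r) *: phi h.
  by rewrite -phiZ to_centreE.
have phi_inj h : phi h = 0 -> h = 0.
  have [f [fZ finj]] := torsion_free_embedding H_prime basisP.
  have [[g gE] _] := phiU _ f fZ; move=> ph; apply: finj.
  by rewrite -gE /= ph linear0.
have spanQ y : exists c : 'I_n -> F, y = \sum_i c i *: phi (w i).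
  have [||U UP] := @vspace_of_closed F Q
      (fun y => exists c : 'I_n -> F, y = \sum_i c i *: phi (w i)).
  - by exists (fun=> 0); rewrite big1 // => i _; rewrite scale0r.
  - move=> k _ _ [c ->] [e ->]; exists (fun i => k * c i + e i).
    rewrite scaler_sumr -big_split; apply: eq_bigr => i _ /=.
    by rewrite scalerDl scalerA.
  apply/UP; have [|_ uniq] := phiU Q phi; first exact: phiZ.
  suff -> : y = projv U y by apply: memv_proj.
  apply: (uniq idfun (projv U)) => // h.
  rewrite /= projv_id //; apply/UP.
  exists (fun i => tofrac (to_centre H_prime (v h 0 i))).
  by rewrite {1}[h]basisP rmorph_sum; apply: eq_bigr => i _; rewrite phiR.
have dF : d%:R != 0 :> F.
  apply/eqP => d0; have := congr1 phi du; rewrite rmorphM rmorph_nat rmorph1.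
  have -> : (d%:R : Q) = (d%:R : F) *: 1 by rewrite scaler_nat.
  by rewrite d0 scale0r mul0r => /esym/eqP; rewrite oner_eq0.
have dimQE : dim Q = (d ^ 2)%N by rewrite -dimvf.
have dimQ0 : (dim Q)%:R != 0 :> F by rewrite dimQE natrX expf_neq0.
(* The rows of [V] are the coordinates of the lattice spanned by the [w i]. *)
have [z zE] : exists z : D, ltrace (phi a) = tofrac z.
  apply: icD.
  pose V : 'M[F]_(n, dim Q) := \matrix_(i, j) v2r (phi (w i)) 0 j.
  have VE i : row i V = v2r (phi (w i)) by apply/rowP => j; rewrite !mxE.
  apply: (@integral_trace _ _ _ n (dim Q) V _
    (\matrix_(i, j) to_centre H_prime (v (a * w i) 0 j))).
    rewrite -sub1mx; apply/row_subP => i; have [c cE] := spanQ (r2v (row i 1%:M)).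
    rewrite -[row i _]r2vK cE linear_sum summx_sub // => j _.
    by rewrite linearZ /= scalemx_sub // -VE row_sub.
  apply/row_matrixP => i; rewrite !row_mul VE mul_f2mx v2rK lfunE /=.
  rewrite -rmorphM [a * w i]basisP rmorph_sum linear_sum mulmx_sum_row.
  by apply: eq_bigr => j _; rewrite phiR linearZ /= !mxE VE.
exists z => b; pose x := (d ^ 2)%:R * a - of_centre z.
suff : frtrace v w x b = 0 by rewrite frtraceBl => /eqP; rewrite subr_eq0 => /eqP.
have [c cE] : exists c : 'I_n -> 'I_n -> F, phi x =
    \sum_i \sum_j c i j *: (phi (w i) * phi (w j) - phi (w j) * phi (w i)).
  apply: (ltrace0_commutators csQ dimQ0 spanQ).
  have -> : phi x = (d ^ 2)%:R *: phi a - tofrac z *: 1.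
    rewrite /x rmorphB rmorphM rmorph_nat; congr (_ - _).
      by rewrite scaler_nat mulr_natl.
    by rewrite -[of_centre z]mulr1 phiZ rmorph1.
  by rewrite linearB !linearZ /= /GRing.scale /= ltrace1 zE dimQE mulrC subrr.
have [s [s0 [t tE]]] := common_denominator (fun ij => c ij.1 ij.2).
have sx : of_centre s * x =
    \sum_i \sum_j of_centre (t (i, j)) * (w i * w j - w j * w i).
  apply/eqP; rewrite -subr_eq0; apply/eqP/phi_inj.
  rewrite rmorphB phiZ cE scaler_sumr rmorph_sum -sumrB big1 // => i _.
  rewrite scaler_sumr rmorph_sum -sumrB big1 // => j _.
  by rewrite phiZ rmorphB !rmorphM scalerA (tE (i, j)) subrr.
have frsx h : frtrace v w (of_centre s * x) h = 0.
  rewrite sx frtrace_suml big1 // => i _; rewrite frtrace_suml big1 // => j _.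
  rewrite (frtrace_centralM v w _ _ (of_centreC _)) frtraceBl.
  by rewrite (frtraceC basisP) subrr.
(* Trading the central factor [s] for a nonzero scalar [r]. *)
have [r [h [r0 sh]]] := central_regular_divides basisP (of_centreC s)
  (fun h => @of_centre_reg _ _ H_prime s h s0).
apply: (scalar_reg r0); rewrite -frtraceZr.
have -> : r *: b = of_centre s * (h * b) by rewrite mulrA sh -scalerAl mul1r.
by rewrite -(frtrace_centralM v w _ _ (of_centreC _)) frsx.
Qed.

End CentralReduction.

(** * Reduction modulo a maximal ideal *)

Section Reduction.
Variables (R : comNzRingType) (H : algType R).
Variables (n : nat) (v : {linear H -> 'rV[R]_n}) (w : 'I_n -> H).
Hypothesis basisP : forall h, h = \sum_i v h 0 i *: w i.
Hypothesis dualP : forall i j, v (w i) 0 j = (i == j)%:R.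
Variables (m : R -> Prop) (K : fieldType) (pi : {rmorphism R -> K}).
Hypothesis K_quo : quotient_map m pi.
Variables (A : falgType K) (q : {rmorphism H -> A}).
Hypothesis A_quo : quotient_map (@extended_ideal R H m) q.
Hypothesis A_alg : forall (r : R) (h : H), q (r *: h) = pi r *: q h.

Lemma q_basis h : q h = \sum_i pi (v h 0 i) *: q (w i).
Proof.
by rewrite {1}[h]basisP rmorph_sum; apply: eq_bigr => i _; rewrite A_alg.
Qed.

(** A relation between the [q (w i)] lifts to an element of [m H], whose
    coordinates lie in [m]. *)
Lemma reduction_basis : basis_of {:A} [tuple q (w i) | i < n].
Proof.
set X := [tuple _ | _ < _]; have XE (i : 'I_n) : X`_i = q (w i).
  by rewrite -tnth_nth tnth_mktuple.
rewrite /basis_of; apply/andP; split.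
  rewrite eqEsubv subvf; apply/subvP => y _; have [h <-] := A_quo.1 y.
  rewrite q_basis rpred_sum // => i _; rewrite rpredZ // -XE memv_span //.
  by rewrite mem_nth ?size_tuple.
apply/freeP => k k0 i; pose r j := projT1 (cid (K_quo.1 (k j))).
have rE j : pi (r j) = k j by rewrite /r; case: cid.
have qr0 : q (\sum_j r j *: w j) = 0.
  rewrite -[RHS]k0 rmorph_sum; apply: eq_bigr => j _.
  by rewrite A_alg rE XE.
have vr : v (\sum_j r j *: w j) 0 i = r i.
  rewrite linear_sum summxE (bigD1 i) //= big1 => [|j ji].
    by rewrite linearZ mxE dualP eqxx mulr1 addr0.
  by rewrite linearZ mxE dualP (negPf ji) mulr0.
have [l [a [g [ma gE]]]] := (A_quo.2 _).1 qr0.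
rewrite -rE -vr gE linear_sum summxE rmorph_sum big1 // => j _.
by rewrite linearZ mxE rmorphM (K_quo.2 _).2 ?mul0r.
Qed.

Lemma trmul_reduction a b : trmul (q a) (q b) = pi (frtrace v w a b).
Proof.
have bX := reduction_basis; rewrite /trmul (lftr_basis _ bX) rmorph_sum.
apply: eq_bigr => i _; rewrite comp_lfunE !lfunE /=.
set X := [tuple _ | _ < _] in bX *.
have XE (j : 'I_n) : X`_j = q (w j) by rewrite -tnth_nth tnth_mktuple.
have -> : q a * (X`_i * q b) = \sum_(j < n) pi (v (a * w i * b) 0 j) *: X`_j.
  rewrite XE mulrA -!rmorphM q_basis; apply: eq_bigr => j _; by rewrite XE.
by rewrite coord_sum_free ?(basis_free bX).
Qed.

End Reduction.

Theorem theorem2p4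
  (R : comNzRingType) (H : algType R)
  (R_sub_H : injective (fun r : R => r%:A : H))
  (H_frob : free_frobenius_extension H)
  (R_reg : regular_ring R)
  (H_prime : prime_ring H)
  (Z_gor : gorenstein_ring (prime_centre H_prime))
  (Z_ic : integrally_closed (prime_centre H_prime))
  (d : nat) (H_pideg : PI_degree H_prime d)
  (d_inv : exists u : H, d%:R * u = 1)
  (m : R -> Prop) (m_max : maximal_ideal m)
  (K : fieldType) (pi : {rmorphism R -> K}) (K_quo : quotient_map m pi)
  (A : falgType K) (q : {rmorphism H -> A})
  (A_quo : quotient_map (@extended_ideal R H m) q)
  (A_alg : forall (r : R) (h : H), q (r *: h) = pi r *: q h)
  (A_split : split_algebra A)
  (k : nat) (B : 'I_k -> {aspace A}) (A_blocks : block_decomposition B)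
  (K0 G0 : 'I_k -> vectType K) (C : forall i, 'Hom(K0 i, G0 i))
  (C_cartan : forall i,
     @cartan_map K (subvs_of (B i)) (K0 i) (G0 i) (C i)) :
  (forall i, \dim (limg (C i)) != 0%N) ->
  forall i, \dim (limg (C i)) = 1%N.
Proof.
move=> C_neq0 i; apply/eqP; rewrite eqn_leq lt0n C_neq0 andbT.
have [[n [v0 vlin [vV vK vVK]]] _] := H_frob.
pose v : {linear H -> 'rV[R]_n} :=
  HB.pack v0 (GRing.isLinear.Build R H 'rV[R]_n _ v0 vlin).
pose w (j : 'I_n) := vV (delta_mx 0 j).
have dualP (j l : 'I_n) : v (w j) 0 l = (j == l)%:R.
  by rewrite /= /w vVK mxE eqxx eq_sym.
have basisP h : h = \sum_j v h 0 j *: w j.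
  apply: (can_inj vK); rewrite -[v0]/(v : H -> _) linear_sum.
  rewrite {1}[v h]row_sum_delta; apply: eq_bigr => j _.
  by rewrite linearZ /= /w vVK.
have d2K : (d ^ 2)%:R != 0 :> K.
  have [u du] := d_inv; rewrite natrX expf_neq0 //; apply/eqP => d0.
  have := congr1 q du; rewrite rmorphM rmorph_nat rmorph1.
  have -> : (d%:R : A) = (d%:R : K) *: 1 by rewrite scaler_nat.
  by rewrite d0 scale0r mul0r => /esym/eqP; rewrite oner_eq0.
have splitA := split_rep A_split.
have [_ _ /(_ i) blk] := A_blocks.
apply: (cartan_rank_le1 (block_split blk splitA) _ (C_cartan i)).
apply: (block_rank1 blk splitA) => a.
have [h <-] := A_quo.1 a.
have [z zE] := central_reduction R_sub_H basisP H_pideg d_inv Z_ic h.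
exists ((d ^ 2)%:R^-1 *: q (of_centre z)); split=> b; have [g <-] := A_quo.1 b.
  by rewrite -scalerAl -scalerAr -!rmorphM of_centreC.
have trZ c x y : trmul (c *: x) y = c * trmul x y :> K.
  rewrite /trmul -lftrZ; congr lftr; apply/lfunP => t.
  by rewrite scale_lfunE !comp_lfunE !lfunE /= scalerAl.
have trq := trmul_reduction basisP dualP K_quo A_quo A_alg.
rewrite trZ [in RHS]trq -zE -trq rmorphM rmorph_nat.
have -> : (d ^ 2)%:R * q h = (d ^ 2)%:R *: q h by rewrite scaler_nat mulr_natl.
by rewrite trZ mulKf.
Qed.
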